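(* Let $\delta\in(0,1)$, $T\ge 1$, $\iota=\log(3A_{\mathcal X}/\delta)$, and run Balanced-FTRL for the max-player with IX parameters $\gamma_h=\sqrt{H\iota/(2A_{\mathcal X}T)}$ for all $h\in[H]$, against an arbitrary (possibly adaptive) sequence of opponent policies $(\nu^t)_{t\in[T]}$. (i) With the Tsallis regularizer of parameter $\alpha\in(0,1)$ and learning rates $\eta_h=\sqrt{2\alpha(1-\alpha)/T}\,(H/A_{\mathcal X})^{\alpha-1/2}$ for all $h$, with probability at least $1-\delta$, $$\mathrm{Reg}^T_{\max}\le\Big(\sqrt{2/(\alpha(1-\alpha))}+3\sqrt{2\iota}\Big)\sqrt{HA_{\mathcal X}T}.$$ (ii) With the Shannon regularizer and learning rates $\eta_h=\sqrt{2H\log(A_{\mathcal X})/(A_{\mathcal X}T)}$ for all $h$, with probability at least $1-\delta$, $$\mathrm{Reg}^T_{\max}\le\Big(\sqrt{2\log(A_{\mathcal X})}+3\sqrt{2\iota}\Big)\sqrt{HA_{\mathcal X}T}.$$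
   Context: Setting. An episodic two-player zero-sum imperfect-information game with horizon $H\in\mathbb N$ and perfect recall. The max-player's information sets form a finite set $\mathcal X=\bigsqcup_{h=1}^H\mathcal X_h$; each $x\in\mathcal X$ has a finite nonempty action set $\mathcal A(x)$ of size $A(x)$. Perfect recall: each $x_h\in\mathcal X_h$ has a unique history $(x_1,a_1,\dots,x_{h-1},a_{h-1},x_h)$ with $x_i\in\mathcal X_i$, $a_i\in\mathcal A(x_i)$. For $h<H$, $\mathcal X_{h+1}(x_h,a_h)$ is the (nonempty) set of $x_{h+1}\in\mathcal X_{h+1}$ whose history contains $(x_h,a_h)$. Write $x'\ge x$ if $x'=x$ or $x$ appears in the history of $x'$. Let $\mathcal A(\mathcal X_h)=\{(x_h,a_h):x_h\in\mathcal X_h,a_h\in\mathcal A(x_h)\}$ and $A_{\mathcal X}=\sum_{x\in\mathcal X}A(x)$. A (max-player) policy is $\mu=(\mu_h(\cdot|x_h))$ with $\mu_h(\cdot|x_h)$ a distribution on $\mathcal A(x_h)$; $\Pi_{\max}$ is the set of policies. Its realization plan is $\mu_{1:h}(x_h,a_h)=\prod_{h'=1}^h\mu_{h'}(a_{h'}|x_{h'})$ along the history of $(x_h,a_h)$. For a min-player policy $\nu$, $p^\nu_0$ is the induced distribution of the max-player's first information set on $\mathcal X_1$, $p^\nu_h(\cdot|x_h,a_h)$ the induced distribution of the next information set on $\mathcal X_{h+1}(x_h,a_h)$, and $r^\nu_h(x_h,a_h)\in[0,1]$ the expected reward; $p^\nu_{1:h}(x_h)=p^\nu_0(x_1)\prod_{h'=1}^{h-1}p^\nu_{h'}(x_{h'+1}|x_{h'},a_{h'})$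 and the loss is $\ell^\nu_h(x_h,a_h)=p^\nu_{1:h}(x_h)(1-r^\nu_h(x_h,a_h))$. For vectors indexed by $\bigcup_h\mathcal A(\mathcal X_h)$, $\langle\mu_{1:},\ell\rangle=\sum_{h}\sum_{(x_h,a_h)\in\mathcal A(\mathcal X_h)}\mu_{1:h}(x_h,a_h)\ell_h(x_h,a_h)$. Protocol. There are $T$ episodes. Before episode $t$ the max-player chooses $\mu^t$ and the opponent $\nu^t$, both measurable w.r.t. $\mathcal F_{t-1}$, where $\mathcal F_t$ is generated by everything observed in episodes $1,\dots,t$ together with $\nu^{t+1}$. In episode $t$, for $h=1,\dots,H$ the max-player observes $x_h^t$, plays $a_h^t\sim\mu^t_h(\cdot|x_h^t)$ and receives $r_h^t\in[0,1]$; conditionally on $\mathcal F_{t-1}$, $\Pr(x^t_h=x_h,a^t_h=a_h)=p^{\nu^t}_{1:h}(x_h)\mu^t_{1:h}(x_h,a_h)$ and $\mathbb E[\mathbb 1\{x^t_h=x_h,a^t_h=a_h\}(1-r^t_h)]=\mu^t_{1:h}(x_h,a_h)\ell^{\nu^t}_h(x_h,a_h)$. The regret is $\mathrm{Reg}^T_{\max}=\max_{\mu^\dagger\in\Pi_{\max}}\sum_{t=1}^T\langle\mu^t_{1:}-\mu^\dagger_{1:},\ell^{\nu^t}\rangle$. Balanced transitions. $A^\tau(x)=\sum_{x'\ge x}A(x')$; $p^\star_0(x_1)=A^\tau(x_1)/A_{\mathcal X}$ for $x_1\in\mathcal X_1$; $p^\star_h(x_{h+1}|x_h,a_h)=A^\tau(x_{h+1})/\sum_{x'\in\mathcal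 X_{h+1}(x_h,a_h)}A^\tau(x')$; $p^\star_{1:h}(x_h)=p^\star_0(x_1)\prod_{h'=1}^{h-1}p^\star_{h'}(x_{h'+1}|x_{h'},a_{h'})$. Balanced-FTRL with learning rates $\eta_h>0$, IX parameters $\gamma_h>0$ and regularizers $\Psi_h$ on $\Delta(\mathcal A(\mathcal X_h))$ (Tsallis: $\Psi_h(w)=-\sum_{(x_h,a_h)}w(x_h,a_h)^\alpha$; Shannon: $\Psi_h(w)=\sum_{(x_h,a_h)}w(x_h,a_h)\log w(x_h,a_h)$): with $\tilde\ell^t_h(x_h,a_h)=\mathbb 1\{x^t_h=x_h,a^t_h=a_h\}(1-r^t_h)/\big(\mu^t_{1:h}(x_h,a_h)+\gamma_h/p^\star_{1:h}(x_h)\big)$ and $\tilde L^t=\sum_{k\le t}\tilde\ell^k$, the policy is $\mu^t\in\arg\min_{\mu\in\Pi_{\max}}\langle\mu_{1:},\tilde L^{t-1}\rangle+\sum_{h=1}^H\Psi_h(p^\star_{1:h}\cdot\mu_{1:h})/\eta_h$, where $(p^\star_{1:h}\cdot\mu_{1:h})(x_h,a_h)=p^\star_{1:h}(x_h)\mu_{1:h}(x_h,a_h)$. *)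

(* Defs.v *)
From HB Require Import structures.
From mathcomp Require Import all_boot all_order all_algebra.
From mathcomp Require Import all_classical all_reals all_analysis.
Set Implicit Arguments. Unset Strict Implicit. Unset Printing Implicit Defensive.
Import Order.TTheory GRing.Theory Num.Theory.
Local Open Scope ring_scope.
Local Open Scope classical_set_scope.

(* The max-player's tree of information sets (perfect recall).              *)
(* X : all information sets (the disjoint union of the layers X_h);         *)
(* A : an ambient finite type of action labels;                             *)
(* lvl x = h  iff  x \in X_h;  avail x = A(x);                              *)
(* par x = None if x \in X_1, and par x = Some (x_{h-1}, a_{h-1}) otherwise *)
(* (the last step of the unique history of x).                              *)
Record infotree (X A : finType) := InfoTree {
  lvl : X -> nat;
  par : X -> option (X * A);
  avail : X -> {set A} }.

Definition wf_infotree (X A : finType) (H : nat) (G : infotree X A) : Prop :=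
  (forall x, (1 <= lvl G x <= H)%N) /\
  (forall x, par G x = None <-> lvl G x = 1%N) /\
  (forall x y b, par G x = Some (y, b) ->
       lvl G x = (lvl G y).+1 /\ b \in avail G y) /\
  (forall x, avail G x != finset.set0) /\
  (forall x a, a \in avail G x -> (lvl G x < H)%N ->
       exists x', par G x' = Some (x, a)).

Definition children (X A : finType) (G : infotree X A) (x : X) (a : A) : {set X} :=
  [set x' | par G x' == Some (x, a)].

Fixpoint is_desc (X A : finType) (G : infotree X A) (n : nat) (x' x : X) : bool :=
  (x' == x) ||
  match n with
  | 0 => false
  | n'.+1 => match par G x' with
             | None => false
             | Some (y, _) => is_desc G n' y x
             end
  end.
Definition desc (X A : finType) (G : infotree X A) (x' x : X) : bool :=
  is_desc G (lvl G x') x' x.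

Definition AX (X A : finType) (G : infotree X A) : nat := \sum_(x : X) #|avail G x|.
Definition Atau (X A : finType) (G : infotree X A) (x : X) : nat :=
  \sum_(x' : X | desc G x' x) #|avail G x'|.

Fixpoint anc_prod (R : realType) (X A : finType) (G : infotree X A)
    (f : X -> A -> R) (n : nat) (x : X) : R :=
  match n with
  | 0 => 1
  | n'.+1 => match par G x with
             | None => 1
             | Some (y, b) => f y b * anc_prod G f n' y
             end
  end.

Definition plan (R : realType) (X A : finType) (G : infotree X A)
    (mu : X -> A -> R) (x : X) (a : A) : R :=
  mu x a * anc_prod G mu (lvl G x) x.

Fixpoint reach_prob (R : realType) (X A : finType) (G : infotree X A)
    (p0 : X -> R) (p : X -> A -> X -> R) (n : nat) (x : X) : R :=
  match n with
  | 0 => p0 x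
  | n'.+1 => match par G x with
             | None => p0 x
             | Some (y, b) => p y b x * reach_prob G p0 p n' y
             end
  end.
Definition seq_prob (R : realType) (X A : finType) (G : infotree X A)
    (p0 : X -> R) (p : X -> A -> X -> R) (x : X) : R :=
  reach_prob G p0 p (lvl G x) x.

Definition is_policy (R : realType) (X A : finType) (G : infotree X A)
    (mu : X -> A -> R) : Prop :=
  forall x, (forall a, 0 <= mu x a) /\ (forall a, a \notin avail G x -> mu x a = 0)
            /\ \sum_(a in avail G x) mu x a = 1.

Definition ip (R : realType) (X A : finType) (G : infotree X A)
    (mu : X -> A -> R) (l : X -> A -> R) : R :=
  \sum_(x : X) \sum_(a in avail G x) plan G mu x a * l x a.

Definition pstar0 (R : realType) (X A : finType) (G : infotree X A) (x : X) : R :=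
  (Atau G x)%:R / (AX G)%:R.
Definition pstar (R : realType) (X A : finType) (G : infotree X A)
    (x : X) (a : A) (x' : X) : R :=
  (Atau G x')%:R / \sum_(x'' in children G x a) ((Atau G x'')%:R : R).
Definition pstar_seq (R : realType) (X A : finType) (G : infotree X A) (x : X) : R :=
  seq_prob G (@pstar0 R X A G) (@pstar R X A G) x.
Arguments pstar0 {R X A} G x.
Arguments pstar {R X A} G x a x'.
Arguments pstar_seq {R X A} G x.

(* Opponent: an arbitrary set Nu of min-player policies, with the induced   *)
(* p^nu_0, p^nu_h(.|x,a), r^nu_h(x,a).                                      *)
Definition wf_opponent (R : realType) (X A : finType) (H : nat) (G : infotree X A)
    (Nu : Type) (p0 : Nu -> X -> R) (ptr : Nu -> X -> A -> X -> R)
    (rw : Nu -> X -> A -> R) : Prop :=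
  forall nu : Nu,
    ((forall x, 0 <= p0 nu x) /\ (forall x, lvl G x <> 1%N -> p0 nu x = 0) /\
     \sum_(x : X | lvl G x == 1%N) p0 nu x = 1) /\
    (forall x a, a \in avail G x -> (lvl G x < H)%N ->
       (forall x', 0 <= ptr nu x a x') /\
       (forall x', x' \notin children G x a -> ptr nu x a x' = 0) /\
       \sum_(x' in children G x a) ptr nu x a x' = 1) /\
    (forall x a, 0 <= rw nu x a <= 1).

Definition loss (R : realType) (X A : finType) (G : infotree X A)
    (Nu : Type) (p0 : Nu -> X -> R) (ptr : Nu -> X -> A -> X -> R)
    (rw : Nu -> X -> A -> R) (nu : Nu) (x : X) (a : A) : R :=
  seq_prob G (p0 nu) (ptr nu) x * (1 - rw nu x a).

(* Regularizers (entrywise): Psi_h(w) = sum_{(x_h,a_h)} psi (w (x_h,a_h))   *)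
Definition tsallis_psi (R : realType) (alpha : R) (w : R) : R := - (w `^ alpha).
Definition shannon_psi (R : realType) (w : R) : R := w * ln w.

Definition ftrl_obj (R : realType) (X A : finType) (H : nat) (G : infotree X A)
    (psi : R -> R) (eta : nat -> R) (L : X -> A -> R) (mu : X -> A -> R) : R :=
  ip G mu L +
  \sum_(1 <= h < H.+1)
     (\sum_(x : X | lvl G x == h) \sum_(a in avail G x)
         psi (pstar_seq G x * plan G mu x a)) / eta h.

(* IX loss estimator of episode t, given the observations xo h, ao h, ro h
   of that episode and the policy mu used in it. *)
Definition ltilde (R : realType) (X A : finType) (G : infotree X A)
    (gamma : nat -> R) (mu : X -> A -> R)
    (xo : nat -> X) (ao : nat -> A) (ro : nat -> R) (x : X) (a : A) : R :=
  if (xo (lvl G x) == x) && (ao (lvl G x) == a) then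
    (1 - ro (lvl G x)) / (plan G mu x a + gamma (lvl G x) / pstar_seq G x)
  else 0.

Definition F_meas_real (R : realType) (Omega : Type) (F : set (set Omega))
    (f : Omega -> R) : Prop :=
  forall c : R, F [set w | f w <= c].
Definition F_meas_fin (Omega : Type) (T : finType) (F : set (set Omega))
    (f : Omega -> T) : Prop :=
  forall v : T, F [set w | f w = v].

(* Episodes t = 1..T, steps h = 1..H.                                       *)
(*  Xo t h, Ao t h, Ro t h : observed x^t_h, played a^t_h, reward r^t_h;    *)
(*  nu t : the opponent's policy nu^t;  mus t : the player's policy mu^t;   *)
(*  F t : the filtration (F_0, F_1, ...), to which everything is adapted    *)
(*        as in the protocol (any such filtration, e.g. the natural one).   *)
Definition balanced_ftrl_run (R : realType) (X A : finType) (H T : nat)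
    (G : infotree X A) (Nu : Type) (p0 : Nu -> X -> R)
    (ptr : Nu -> X -> A -> X -> R) (rw : Nu -> X -> A -> R)
    (psi : R -> R) (eta gamma : nat -> R)
    (d : measure_display) (Omega : measurableType d) (P : probability Omega R)
    (F : nat -> set (set Omega))
    (Xo : nat -> nat -> Omega -> X) (Ao : nat -> nat -> Omega -> A)
    (Ro : nat -> nat -> Omega -> R)
    (nu : nat -> Omega -> Nu) (mus : nat -> Omega -> X -> A -> R) : Prop :=
  (forall t, sigma_algebra setT (F t)) /\
  (forall t, F t `<=` measurable) /\
  (forall t, F t `<=` F t.+1) /\
  (forall t h, (1 <= t <= T)%N -> (1 <= h <= H)%N ->
     F_meas_fin (F t) (Xo t h) /\ F_meas_fin (F t) (Ao t h) /\
     F_meas_real (F t) (Ro t h) /\ (forall w, 0 <= Ro t h w <= 1)) /\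
  (forall t, (1 <= t <= T)%N -> forall x a x',
     F_meas_real (F t.-1) (fun w => p0 (nu t w) x) /\
     F_meas_real (F t.-1) (fun w => ptr (nu t w) x a x') /\
     F_meas_real (F t.-1) (fun w => rw (nu t w) x a)) /\
  (forall t, (1 <= t <= T)%N -> forall x a,
     F_meas_real (F t.-1) (fun w => mus t w x a)) /\
  (forall t, (1 <= t <= T)%N -> forall w,
     let Lt := fun x a => \sum_(1 <= k < t)
                 ltilde G gamma (mus k w) (fun h => Xo k h w) (fun h => Ao k h w)
                        (fun h => Ro k h w) x a in
     is_policy G (mus t w) /\
     forall mu', is_policy G mu' ->
       ftrl_obj H G psi eta Lt (mus t w) <= ftrl_obj H G psi eta Lt mu') /\
  (* conditional laws given F_{t-1} *)
  (forall t, (1 <= t <= T)%N -> forall x a, a \in avail G x ->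
     forall B, F t.-1 B ->
     P (B `&` [set w | Xo t (lvl G x) w = x /\ Ao t (lvl G x) w = a]) =
       (\int[P]_(w in B)
          (seq_prob G (p0 (nu t w)) (ptr (nu t w)) x * plan G (mus t w) x a)%:E)%E /\
     (\int[P]_(w in B)
        (if (Xo t (lvl G x) w == x) && (Ao t (lvl G x) w == a)
         then 1 - Ro t (lvl G x) w else 0)%:E)%E =
       (\int[P]_(w in B)
          (plan G (mus t w) x a * loss G p0 ptr rw (nu t w) x a)%:E)%E).

Definition regret_vs (R : realType) (X A : finType) (T : nat) (G : infotree X A)
    (Nu : Type) (p0 : Nu -> X -> R) (ptr : Nu -> X -> A -> X -> R)
    (rw : Nu -> X -> A -> R) (Omega : Type)
    (nu : nat -> Omega -> Nu) (mus : nat -> Omega -> X -> A -> R)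
    (mud : X -> A -> R) (w : Omega) : R :=
  \sum_(1 <= t < T.+1)
     (ip G (mus t w) (loss G p0 ptr rw (nu t w)) - ip G mud (loss G p0 ptr rw (nu t w))).

(* "Reg^T_max <= b with probability at least 1 - delta" : the event
   {Reg <= b} = {forall mu^dagger, sum_t <mu^t - mu^dagger, l^t> <= b}
   contains a measurable event of probability >= 1 - delta. *)
Definition regret_whp (R : realType) (X A : finType) (T : nat) (G : infotree X A)
    (Nu : Type) (p0 : Nu -> X -> R) (ptr : Nu -> X -> A -> X -> R)
    (rw : Nu -> X -> A -> R)
    (d : measure_display) (Omega : measurableType d) (P : probability Omega R)
    (nu : nat -> Omega -> Nu) (mus : nat -> Omega -> X -> A -> R)
    (delta b : R) : Prop :=
  exists E : set Omega, measurable E /\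
    E `<=` [set w | forall mud, is_policy G mud ->
                      regret_vs T G p0 ptr rw nu mus mud w <= b] /\
    ((1 - delta)%:E <= P E)%E.

(* Main.v *)
Require Import Defs.
From HB Require Import structures.
From mathcomp Require Import all_boot all_order all_algebra.
From mathcomp Require Import all_classical all_reals all_analysis.
From mathcomp Require Import measurable_realfun ring lra.
Import Order.TTheory GRing.Theory Num.Theory.
Import numFieldNormedType.Exports.
Local Open Scope ring_scope.

(* With A = AX G and U = sqrt (2 iota H A T), the regret splits into four parts.
   The bias of the IX estimates of the played policies is at most T gamma A = U/2,
   because the balanced transitions satisfy sum_(x,a) p^nu(x) / pstar(x) = A for
   every opponent nu.  The deviation of <mu^t, ltilde^t> below its conditional
   mean is at most U, by an exponential supermartingale.  The bias on the
   comparator is at most H iota / (2 gamma) = U/2, by one exponential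
   supermartingale per pair (x,a), built on (2 - d) exp d <= 2 + d.  The remaining
   FTRL term is a penalty, bounded by the tangent of psi at H/A, plus a stability
   term linear in sum_t sum_(x,a) ltilde^t(x,a) / pstar(x), which the comparator
   event already controls.  Since the bound is trivial unless it is below H T,
   the fluctuation of the stability term costs at most another U/2. *)

Set Implicit Arguments.
Unset Strict Implicit.
Unset Printing Implicit Defensive.

(** * Scalar inequalities *)

(** Two difficulties shape the argument. The best comparator depends on the whole run, so no tail
    bound applies to it directly; but its loss is linear in its realization plan, so one event per
    pair [(x, a)] covers all comparators at once. Together with the event for the played policies
    this makes [AX + 1] events of probability [exp (- iota) = delta / (3 AX)] each, at most [delta]
    in total. The other difficulty is that the Tsallis stability term carries the power
    [v ^ (2 - alpha)] of the weights [v = pstar * plan], and these events control only expressions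
    linear in the estimates. The concave factor [v ^ (1 - alpha)] is therefore replaced by its
    tangent at [H / AX], the average weight. This is the origin of the affine factor [k0 + k1 * v],
    and the stated constant is still reached exactly. *)

Lemma le_of_derive_ge0 (R : realType) (f f' : R -> R) (b : R) :
  (forall x : R, is_derive x 1 f (f' x)) ->
  (forall x, 0 <= x -> x <= b -> 0 <= f' x) -> 0 <= b -> f 0 <= f b.
Proof.
move=> fE f'0; rewrite le_eqVlt => /predU1P[<-//|b0].
have fc : {within `[0, b]%classic, continuous f}%classic.
  apply: continuous_subspaceT => x.
  by apply: differentiable_continuous; apply/derivable1_diffP; apply: ex_derive.
have [c cab fE'] := MVT b0 (fun x _ => fE x) fc.
move: cab; rewrite in_itv/= => /andP[c0 cb].
rewrite -subr_ge0 fE' mulr_ge0 ?subr_ge0 ?(ltW b0)//.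
by rewrite f'0 ?ltW.
Qed.

(** Convexity of exp between [0] and [z], from the tangent line at [a * z]: in the combination with
    weights [a] and [1 - a] the linear terms cancel. *)
Lemma expR_convex_le (R : realType) (a z : R) : 0 <= a <= 1 ->
  expR (a * z) <= 1 - a + a * expR z.
Proof.
move=> /andP[a0 a1].
have e0 := expR_gt0 (a * z).
have h1 : expR (a * z) * (1 + (1 - a) * z) <= expR z.
  have -> : expR z = expR (a * z) * expR ((1 - a) * z).
    by rewrite -expRD; congr expR; ring.
  by rewrite ler_pM2l// expR_ge1Dx.
have h2 : expR (a * z) * (1 - a * z) <= 1.
  apply: le_trans (_ : expR (a * z) * expR (- (a * z)) <= 1).
    by rewrite ler_pM2l// expR_ge1Dx.
  by rewrite -expRD subrr expR0.
have := lerD (ler_wpM2l a0 h1) (ler_wpM2l (_ : 0 <= 1 - a) h2).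
rewrite subr_ge0 => /(_ a1); nra.
Qed.

Lemma powR_le_tangent (R : realType) (a y : R) : 0 <= a <= 1 -> 0 <= y ->
  y `^ a <= 1 - a + a * y.
Proof.
move=> /andP[a0 a1]; rewrite le_eqVlt => /predU1P[<-|y0].
  rewrite mulr0 addr0; have [->|an0] := eqVneq a 0; first by rewrite powRr0 subr0.
  by rewrite powR0// subr_ge0.
rewrite /powR gt_eqF//; apply: le_trans (@expR_convex_le _ _ (ln y) _) _.
  by rewrite a0.
by rewrite lnK.
Qed.

Lemma powR_le_tangent_at (R : realType) (a y u : R) : 0 <= a <= 1 -> 0 <= y -> 0 < u ->
  y `^ a <= (1 - a) * u `^ a + a * u `^ (a - 1) * y.
Proof.
move=> a01 y0 u0.
have -> : y = u * (y / u) by rewrite mulrC divfK ?gt_eqF.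
have yu : 0 <= y / u by rewrite divr_ge0// ltW.
rewrite powRM ?(ltW u0)//.
have -> : a * u `^ (a - 1) * (u * (y / u)) = u `^ a * (a * (y / u)).
  rewrite powRB ?(gt_eqF u0) ?implybT// powRr1 ?(ltW u0)//.
  by field; rewrite gt_eqF.
have -> : (1 - a) * u `^ a + u `^ a * (a * (y / u)) = u `^ a * (1 - a + a * (y / u)).
  by ring.
rewrite ler_wpM2l ?powR_ge0//.
exact: powR_le_tangent.
Qed.

Lemma expRN_le_quadratic (R : realType) (x : R) : 0 <= x ->
  expR (- x) <= 1 - x + x ^+ 2 / 2.
Proof.
move=> x0; rewrite -subr_ge0.
pose f := fun x : R => 1 - x + x ^+ 2 / 2 - expR (- x).
have := @le_of_derive_ge0 R f (fun x => -1 + x + expR (- x)) x.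
have -> : f 0 = 0 by rewrite /f oppr0 expR0; field.
apply => //.
- move=> y; apply: is_derive_eq; rewrite /GRing.scale/=; by field.
- by move=> y _ _; have := expR_ge1Dx (- y); lra.
Qed.

(** The bound of exp by its Pade quotient [(2 + d) / (2 - d)], in product form so as to cover
    [d = 2], the value met when the IX weight [mu] vanishes. The difference of the two sides has
    derivative [1 - (1 - x) * exp x], nonnegative because [exp (- x) >= 1 - x]. *)
Lemma expR_pade (R : realType) (d : R) : 0 <= d -> (2 - d) * expR d <= 2 + d.
Proof.
move=> d0; rewrite -subr_ge0.
pose f := fun x : R => 2 + x - (2 - x) * expR x.
have := @le_of_derive_ge0 R f (fun x => 1 - (1 - x) * expR x) d.
have -> : f 0 = 0 by rewrite /f expR0; ring.
apply => //.
- move=> y; apply: is_derive_eq; rewrite /GRing.scale/=; by ring.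
- move=> y _ _; have := expR_ge1Dx (- y).
  rewrite -(ler_pM2r (expR_gt0 y)) -expRD addNr expR0; lra.
Qed.

(** Taylor expansion at [1], whose cubic term has the favourable sign for [y <= 1]. The substitution
    [y = exp (- z)] moves the singularity at [0] to infinity and reduces the sign of the derivative
    to [1 + x <= exp x], used twice. *)
Lemma powR_second_order (R : realType) (a y : R) : 0 <= a <= 1 -> 0 <= y <= 1 ->
  y `^ a <= 1 - a * (1 - y) - a * (1 - a) / 2 * (1 - y) ^+ 2.
Proof.
move=> /andP[a0 a1] /andP[]; rewrite le_eqVlt => /predU1P[<- _|y0 y1].
  have [->|an0] := eqVneq a 0; first by rewrite powRr0; lra.
  by rewrite powR0//; nra.
pose z := - ln y.
have z0 : 0 <= z by rewrite oppr_ge0 ln_le0.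
have yE : y = expR (- z) by rewrite opprK lnK.
rewrite yE -expRM -subr_ge0.
pose f := fun z : R => 1 - a * (1 - expR (- z)) - a * (1 - a) / 2 * (1 - expR (- z)) ^+ 2
  - expR (- z * a).
have := @le_of_derive_ge0 R f (fun z => - a * expR (- z)
   - a * (1 - a) * (1 - expR (- z)) * expR (- z) + a * expR (- z * a)) z.
have -> : f 0 = 0 by rewrite /f oppr0 mul0r expR0; field.
apply => //.
- move=> w; apply: is_derive_eq; rewrite /GRing.scale/=; by field.
- move=> w w0 _.
  have -> : expR (- w * a) = expR (- w) * expR ((1 - a) * w).
    by rewrite -expRD; congr expR; ring.
  have h1 := expR_ge1Dx ((1 - a) * w).
  have h2 := expR_ge1Dx (- w).
  have h3 : 0 <= (1 - a) * (w - 1 + expR (- w)) by apply: mulr_ge0; lra.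
  have e0 := expR_gt0 (- w).
  have -> : - a * expR (- w) - a * (1 - a) * (1 - expR (- w)) * expR (- w) +
     a * (expR (- w) * expR ((1 - a) * w)) =
     a * expR (- w) * (expR ((1 - a) * w) - 1 - (1 - a) * (1 - expR (- w))) by ring.
  by rewrite mulr_ge0 ?mulr_ge0 ?(ltW e0)//; lra.
Qed.

Lemma ix_moment_le (R : realType) (mu g y : R) : 0 <= mu -> 0 < g -> 0 <= y <= 1 ->
  expR (2 * g * (y / (mu + g))) <= 1 + y * (expR (2 * g / (mu + g)) - 1).
Proof.
move=> mu0 g0 y01; have := expR_convex_le (2 * g / (mu + g)) y01.
have -> : 2 * g * (y / (mu + g)) = y * (2 * g / (mu + g)) by ring.
by move=> h; apply: le_trans h _; lra.
Qed.

(** Since [(2 - d) * (mu + g) = 2 * mu] and [(2 + d) * (mu + g) = 2 * mu + 4 * g], this is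
    [expR_pade] multiplied by [mu + g]. The shift [g] in the denominator thus pays for
    exponentiating the estimate at rate [2 * g]. *)
Lemma ix_weight_le (R : realType) (mu g : R) : 0 <= mu -> 0 < g ->
  mu * (expR (2 * g / (mu + g)) - 1) <= 2 * g.
Proof.
move=> mu0 g0; set d := 2 * g / (mu + g).
have mg : 0 < mu + g by lra.
have d0 : 0 <= d by rewrite divr_ge0//; lra.
have dE : d * (mu + g) = 2 * g by rewrite divfK ?gt_eqF.
have h := expR_pade d0.
have e1 : (2 - d) * (mu + g) = 2 * mu by rewrite mulrBl dE; ring.
have h2 : (mu + g) * ((2 - d) * expR d) <= (mu + g) * (2 + d) by rewrite ler_pM2l.
have h3 : 2 * mu * expR d <= 2 * (mu + g) + 2 * g.
  by apply: le_trans (_ : _ <= (mu + g) * (2 + d)) _; [rewrite -e1|]; lra.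
lra.
Qed.

(** One coordinate of the stability bound: how much a loss [x], already scaled by the learning rate,
    can gain from a move of the weight from [v] to [u] against the Bregman divergence of [psi]. The
    factor [v * (k0 + k1 * v)] plays the part of half the inverse second derivative of [psi] at
    [v]. *)
Definition stable_regularizer {R : realType} (psi dpsi : R -> R) (k0 k1 : R) :=
  forall u v x : R, 0 <= u -> 0 < v -> 0 <= x ->
    - (x ^+ 2 * v * (k0 + k1 * v)) <= psi u - psi v - dpsi v * (u - v) + x * (u - v).

(** For fixed [v] the minimum over [u] is at [v * exp (- x)]; [key] expresses this through
    [ln z <= z - 1]. The minimal value [v * (1 - x - exp (- x))] is at least [- v * x ^ 2 / 2]. *)
Lemma shannon_stable (R : realType) :
  stable_regularizer (@shannon_psi R) (fun v => ln v + 1) (1 / 2) 0.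
Proof.
move=> u v x u0 v0 x0; rewrite /shannon_psi.
have e0 := expR_gt0 (- x).
have hq := expRN_le_quadratic x0.
have key : u - v * expR (- x) <= u * ln u - u * ln v + x * u.
  move: u0; rewrite le_eqVlt => /predU1P[<-|u0].
    by rewrite !mul0r mulr0 subrr sub0r add0r oppr_le0 mulr_ge0 ?ltW.
  have := @le_ln1Dx R (v * expR (- x) / u - 1).
  rewrite subrKC ltrBDr addNr divr_gt0 ?mulr_gt0// => /(_ isT).
  rewrite lnM ?posrE ?mulr_gt0 ?invr_gt0// lnM ?posrE// lnV ?posrE// expRK => h.
  have := ler_wpM2l (ltW u0) h.
  have -> : u * (v * expR (- x) / u - 1) = v * expR (- x) - u by field; rewrite gt_eqF.
  by lra.
have := ler_wpM2l (ltW v0) hq.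
lra.
Qed.

(** The natural factor is [v ^ (1 - a) / (2 * a * (1 - a))]; [k0] and [k1] are the coefficients of
    its tangent at [u0], which lies above it by concavity. *)
Lemma tsallis_stable (R : realType) (a u0 : R) : 0 < a < 1 -> 0 < u0 ->
  stable_regularizer (@tsallis_psi R a) (fun v => - (a * v `^ (a - 1)))
    (u0 `^ (1 - a) / (2 * (1 - a))) (u0 `^ (- a) / (2 * a)).
Proof.
move=> /andP[a0 a1] u00 u v x ug0 v0 x0; rewrite /tsallis_psi.
set k0 := _ / _; set k1 := u0 `^ (- a) / _.
have P0 : 0 < v `^ a by exact: powR_gt0.
have m0 : 0 < v `^ (1 - a) by exact: powR_gt0.
have PmE : v `^ a * v `^ (1 - a) = v.
  rewrite -powRD ?(gt_eqF v0) ?implybT//.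
  have -> : a + (1 - a) = 1 by ring.
  by rewrite powRr1 ?ltW.
have P'E : v `^ (a - 1) * v = v `^ a.
  by rewrite powRB ?(gt_eqF v0) ?implybT// powRr1 ?ltW// divfK ?gt_eqF.
have Km : v `^ (1 - a) <= 2 * a * (1 - a) * (k0 + k1 * v).
  apply: le_trans (@powR_le_tangent_at _ (1 - a) v u0 _ _ _) _ => //; try lra.
  have -> : 1 - a - 1 = - a by ring.
  rewrite le_eqVlt; apply/orP; left; apply/eqP; rewrite /k0 /k1.
  by field; apply/andP; split; rewrite gt_eqF//; lra.
have K0 : 0 <= k0 + k1 * v.
  rewrite -(@pmulr_rge0 _ (2 * a * (1 - a))); first exact: le_trans (ltW m0) Km.
  by rewrite !mulr_gt0//; lra.
(* For [v <= u] the divergence and [x * (u - v)] are both nonnegative; curvature enters only when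
   the weight decreases. *)
have [vu|uv] := leP v u.
  have hD : u `^ a <= (1 - a) * v `^ a + a * v `^ (a - 1) * u.
    by apply: powR_le_tangent_at => //; lra.
  have h1 : 0 <= x * (u - v) by rewrite mulr_ge0 ?subr_ge0.
  have h2 : 0 <= x ^+ 2 * v * (k0 + k1 * v) by rewrite !mulr_ge0 ?sqr_ge0// ltW.
  have h3 : a * v `^ (a - 1) * v = a * v `^ a by rewrite -mulrA P'E.
  by lra.
pose y := u / v.
have uE : u = v * y by rewrite mulrC divfK ?gt_eqF.
have y01 : 0 <= y <= 1.
  by rewrite divr_ge0 ?(ltW v0)//= ler_pdivrMr// mul1r ltW.
have a01 : 0 <= a <= 1 by rewrite !ltW.
have /(ler_wpM2l (ltW P0)) := powR_second_order a01 y01.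
rewrite -powRM ?(ltW v0)//; last by case/andP: y01.
rewrite -uE.
set P := v `^ a in P0 PmE P'E *; set m := v `^ (1 - a) in m0 PmE Km *.
set K := k0 + k1 * v in Km K0 *.
move=> hu.
pose q := 1 - y.
have e1 : a * v `^ (a - 1) * (u - v) = - (a * P * q).
  by rewrite -P'E uE /q; ring.
have e2 : x * (u - v) = - (x * P * m * q) by rewrite uE -PmE /q; ring.
have e3 : x ^+ 2 * v * K = x ^+ 2 * P * m * K by rewrite -PmE; ring.
rewrite mulNr e1 e2 e3.
have c0 : 0 < a * (1 - a) by rewrite mulr_gt0//; lra.
have h4 : x ^+ 2 * P * m * (m / (2 * (a * (1 - a)))) <= x ^+ 2 * P * m * K.
  rewrite ler_wpM2l ?mulr_ge0 ?sqr_ge0 ?(ltW P0) ?(ltW m0)//.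
  by rewrite ler_pdivrMr ?mulr_gt0//; lra.
(* The square completed in [q], the relative decrease of the weight. *)
have h5 : 0 <= P / (2 * (a * (1 - a))) * (a * (1 - a) * q - x * m) ^+ 2.
  by rewrite mulr_ge0 ?sqr_ge0// divr_ge0 ?(ltW P0)// mulr_ge0// ltW.
have e6 : P / (2 * (a * (1 - a))) * (a * (1 - a) * q - x * m) ^+ 2 =
   P * (a * (1 - a) / 2 * q ^+ 2) - x * P * m * q + x ^+ 2 * P * m * (m / (2 * (a * (1 - a)))).
  by field; apply/andP; split; rewrite gt_eqF//; lra.
rewrite /q in e6 h5 *.
lra.
Qed.

(** * Information trees and balanced transitions *)

Section InfoTree.
Variables (R : realType) (X A : finType) (H : nat) (G : infotree X A).
Hypothesis wfG : wf_infotree H G.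
Implicit Types (mu : X -> A -> R) (q : X -> R) (p : X -> A -> X -> R).

Lemma lvl_bounds x : (1 <= lvl G x <= H)%N.
Proof. by case: wfG. Qed.

Lemma par_lvl1 x : par G x = None <-> lvl G x = 1%N.
Proof. by case: wfG => _ []. Qed.

Lemma par_some x y b : par G x = Some (y, b) ->
  lvl G x = (lvl G y).+1 /\ b \in avail G y.
Proof. by case: wfG => _ [_ [h _]]; exact: h. Qed.

Lemma avail_gt0 x : (0 < #|avail G x|)%N.
Proof. by case: wfG => _ [_ [_ [h _]]]; rewrite card_gt0 h. Qed.

Lemma children_neq0 x a : a \in avail G x -> (lvl G x < H)%N ->
  exists x', x' \in children G x a.
Proof.
case: wfG => _ [_ [_ [_ h]]] ax xH; have [x' px'] := h _ _ ax xH.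
by exists x'; rewrite inE px'.
Qed.

Lemma lvl_ind (Q : X -> Prop) :
  (forall x, par G x = None -> Q x) ->
  (forall x y b, par G x = Some (y, b) -> b \in avail G y -> Q y -> Q x) ->
  forall x, Q x.
Proof.
move=> Q0 QS x; have [n] := ubnP (lvl G x).
elim: n x => // n IHn x; rewrite ltnS => xn.
case pE: (par G x) => [[y b]|]; last exact: Q0.
have [xE by_] := par_some pE.
by apply: QS pE by_ (IHn _ _); rewrite -xE.
Qed.

Lemma lvl_eq1 x : (lvl G x == 1)%N = (par G x == None).
Proof. by apply/eqP/eqP => /par_lvl1. Qed.

Lemma sum_children (V : nmodType) (F : X -> V) (h : nat) : (0 < h)%N ->
  \sum_(x | lvl G x == h.+1) F x =
  \sum_(x | lvl G x == h) \sum_(a in avail G x) \sum_(x' in children G x a) F x'.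
Proof.
move=> h0.
(* Layer [h.+1] is partitioned by parent pairs. The default of [odflt] concerns roots only, which
   [0 < h] excludes from this layer. *)
rewrite pair_big_dep/= (partition_big (fun x => odflt (x, xchoose (set0Pn _ (let: conj _ (conj _ (conj _ (conj e _))) := wfG in e x))) (par G x))
  (fun p : X * A => (lvl G p.1 == h) && (p.2 \in avail G p.1))) /=.
  apply: eq_bigr => -[y b] /= /andP[yh yb]; apply: eq_bigl => x.
  rewrite inE; apply/andP/eqP => [[xh]|pE].
    case pE : (par G x) => [[z c]|] /= /eqP; first by move=> ->.
    by move/par_lvl1: pE h0 xh => ->; case: (h).
  by have [-> _] := par_some pE; rewrite pE/= (eqP yh) !eqxx.
move=> x /eqP xh; case pE : (par G x) => [[z c]|] /=.
  by have [+ ->] := par_some pE; rewrite xh => -[->]; rewrite eqxx.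
by move/par_lvl1: pE h0; rewrite xh => -[->].
Qed.

(** The fuel [lvl G x'] is the length of the history of [x'], so one unfolding leaves exactly the
    fuel of the parent. *)
Lemma desc_par x' x : desc G x' x =
  (x' == x) || (if par G x' is Some (y, _) then desc G y x else false).
Proof.
rewrite {1}/desc; case pE: (par G x') => [[y b]|].
  by have [-> _] := par_some pE; rewrite /= pE.
by have /par_lvl1 -> := pE; rewrite /= pE.
Qed.

Lemma desc_lvl x' x : desc G x' x -> (lvl G x <= lvl G x')%N.
Proof.
elim/lvl_ind: x' => [x' pE|x' y b pE _ IH]; rewrite desc_par pE.
  by rewrite orbF => /eqP ->.
have [-> _] := par_some pE.
by move=> /predU1P[<-|/IH /leqW//]; have [-> _] := par_some pE.
Qed.

(** A proper descendant of [x] lies below exactly one child. As an equation between numbers this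
    gives coverage and disjointness together, which is what the recursion for [Atau] needs; levels
    rule out double counting. *)
Lemma desc_split x' x : (desc G x' x = (x' == x) +
  \sum_(a in avail G x) \sum_(c in children G x a) desc G x' c :> nat)%N.
Proof.
rewrite pair_big_dep/=.
elim/lvl_ind: x' => [x' pE|x' y b pE yb IH]; rewrite desc_par pE.
  rewrite orbF big1 ?addn0// => -[a c]/= /andP[_]; rewrite inE => /eqP cE.
  by rewrite desc_par pE orbF; case: eqP => // x'c; rewrite x'c cE in pE.
have [lE _] := par_some pE.
have -> : ((x' == x) || desc G y x : nat) = ((x' == x) + desc G y x)%N.
  case: (x' =P x) => //= x'x; case dE : (desc G y x) => //.
  by have := desc_lvl dE; rewrite -x'x lE ltnn.
congr addn; rewrite {}IH.
under [in RHS]eq_bigr => p _.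
  have -> : (desc G x' p.2 : nat) = ((x' == p.2) + desc G y p.2)%N.
    rewrite desc_par pE; case: (x' =P p.2) => //= x'p.
    by case dE : (desc G y p.2) => //; have := desc_lvl dE; rewrite -x'p lE ltnn.
  over.
rewrite /= big_split/=; congr addn.
have [yx|yx] := eqVneq y x.
  rewrite (bigD1 (b, x')) /=; last by rewrite inE pE -yx yb eqxx.
  rewrite eqxx big1 => // -[a c]/= /andP[/andP[_]]; rewrite inE => /eqP cE.
  case: (x' =P c) => // x'c; rewrite -x'c pE in cE *.
  by case: cE => _ ->; rewrite eqxx.
rewrite big1 // => -[a c]/= /andP[_]; rewrite inE => /eqP cE.
case: (x' =P c) => // x'c; rewrite -x'c pE in cE.
by case: cE yx => ->; rewrite eqxx.
Qed.

Lemma desc_root x' : (\sum_(c | lvl G c == 1%N) desc G x' c = 1 :> nat)%N.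
Proof.
elim/lvl_ind: x' => [x' pE|x' y b pE yb IH].
  rewrite (bigD1 x') ?lvl_eq1 ?pE//= desc_par eqxx big1// => c /andP[_ cx].
  by rewrite desc_par pE eq_sym (negbTE cx).
rewrite -[RHS]IH; apply: eq_bigr => c; rewrite lvl_eq1 => /eqP cE.
rewrite desc_par pE; case: eqP => // x'c.
by rewrite x'c cE in pE.
Qed.

Lemma AtauE x : Atau G x = (\sum_(x' | desc G x' x) #|avail G x'|)%N.
Proof. by []. Qed.

Lemma AXE : AX G = (\sum_x #|avail G x|)%N.
Proof. by []. Qed.

Lemma Atau_split x : Atau G x = (#|avail G x| +
  \sum_(a in avail G x) \sum_(c in children G x a) Atau G c)%N.
Proof.
under [in RHS]eq_bigr do under eq_bigr do rewrite AtauE.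
rewrite AtauE big_mkcond/=.
under eq_bigr => x' _.
  have -> : (if desc G x' x then #|avail G x'| else 0%N) = (desc G x' x * #|avail G x'|)%N.
    by case: (desc _ _ _); rewrite ?mul1n ?mul0n.
  rewrite desc_split mulnDl; over.
rewrite big_split/=; congr addn.
  rewrite (bigD1 x)//= eqxx mul1n big1 ?addn0// => x' /negbTE ->.
  by rewrite mul0n.
under eq_bigr do rewrite big_distrl/=.
rewrite exchange_big/=; apply: eq_bigr => a _.
under eq_bigr do rewrite big_distrl/=.
rewrite exchange_big/=; apply: eq_bigr => c _.
rewrite [RHS]big_mkcond/=; apply: eq_bigr => x' _.
by case: (desc _ _ _); rewrite ?mul1n ?mul0n.
Qed.

Lemma Atau_root : (\sum_(c | lvl G c == 1%N) Atau G c = AX G)%N.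
Proof.
rewrite AXE; under eq_bigr do rewrite AtauE big_mkcond/=.
rewrite exchange_big/=; apply: eq_bigr => x _.
rewrite -[RHS]mul1n -[X in _ = (X * _)%N](desc_root x) big_distrl/=; apply: eq_bigr => c _.
by case: (desc _ _ _); rewrite ?mul1n ?mul0n.
Qed.

Lemma Atau_gt0 x : (0 < Atau G x)%N.
Proof. by rewrite Atau_split addn_gt0 avail_gt0. Qed.

Lemma AX_ge_card : (#|X| <= AX G)%N.
Proof.
rewrite -sum1_card AXE; apply: leq_sum => x _; exact: avail_gt0.
Qed.

Lemma seq_prob_root q p x : par G x = None -> seq_prob G q p x = q x.
Proof. by move=> pE; rewrite /seq_prob; have /par_lvl1 -> := pE; rewrite /= pE. Qed.

Lemma seq_prob_par q p x y b : par G x = Some (y, b) ->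
  seq_prob G q p x = p y b x * seq_prob G q p y.
Proof. by move=> pE; rewrite /seq_prob; have [-> _] := par_some pE; rewrite /= pE. Qed.

Lemma pstar_denom_gt0 x y b : par G x = Some (y, b) ->
  0 < \sum_(x'' in children G y b) ((Atau G x'')%:R : R).
Proof.
move=> pE; rewrite (bigD1 x) ?inE ?pE//= ltr_pwDl ?ltr0n ?Atau_gt0//.
by apply: sumr_ge0 => *; rewrite ler0n.
Qed.

Lemma AX_gt0 (x : X) : (0 < AX G)%N.
Proof. by apply: leq_trans AX_ge_card; apply/card_gt0P; exists x. Qed.

Lemma horizon_gt0 (x : X) : (0 < H)%N.
Proof. by have /andP[h1 h2] := lvl_bounds x; exact: leq_trans h2. Qed.

Lemma pstar_seq_gt0 x : 0 < pstar_seq G x :> R.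
Proof.
rewrite /pstar_seq; elim/lvl_ind: x => [x pE|x y b pE yb IH].
  by rewrite seq_prob_root// divr_gt0 ?ltr0n ?Atau_gt0// AX_gt0.
by rewrite (seq_prob_par _ _ pE) mulr_gt0// divr_gt0 ?(pstar_denom_gt0 pE)// ltr0n Atau_gt0.
Qed.

(** Common to the opponent's kernels and the balanced ones. Normalization is asked where the tree
    continues; elsewhere there are no children and the denominator of [pstar] is an empty sum. *)
Definition transition (q : X -> R) (p : X -> A -> X -> R) :=
  ((forall x, 0 <= q x) /\ \sum_(x : X | lvl G x == 1%N) q x = 1) /\
  (forall x a, a \in avail G x -> (lvl G x < H)%N ->
     (forall x', 0 <= p x a x') /\ \sum_(x' in children G x a) p x a x' = 1).

(** The argument [x] witnesses that the tree is nonempty; in an empty tree the root weights sum to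
    [0]. *)
Lemma pstar_transition (x : X) : transition (pstar0 G) (pstar G).
Proof.
split; [split=> [y|]|move=> y a ya yH; split=> [x'|]].
- by rewrite divr_ge0.
- rewrite -mulr_suml -natr_sum Atau_root divff// pnatr_eq0 -lt0n.
  exact: AX_gt0.
- by rewrite divr_ge0// sumr_ge0.
- rewrite /pstar -mulr_suml divff// gt_eqF//.
  by have [c] := children_neq0 ya yH; rewrite inE => /eqP/pstar_denom_gt0.
Qed.

Lemma par_lt_H x y b : par G x = Some (y, b) -> (lvl G y < H)%N.
Proof. by move=> /par_some[<- _]; case/andP: (lvl_bounds x). Qed.

Lemma seq_prob_ge0 q p x : transition q p -> 0 <= seq_prob G q p x.
Proof.
move=> [[p00 _] hp]; elim/lvl_ind: x => [x pE|x y b pE yb IH].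
  by rewrite seq_prob_root.
by rewrite (seq_prob_par _ _ pE) mulr_ge0//; case: (hp _ _ yb (par_lt_H pE)).
Qed.

Lemma plan_root mu x a : par G x = None -> plan G mu x a = mu x a :> R.
Proof. by move=> pE; rewrite /plan; have /par_lvl1 -> := pE; rewrite /= pE mulr1. Qed.

Lemma plan_par mu x y b a : par G x = Some (y, b) ->
  plan G mu x a = mu x a * plan G mu y b :> R.
Proof. by move=> pE; rewrite /plan; have [-> _] := par_some pE; rewrite /= pE. Qed.

(** The player's share of the probability of arriving at [x], before acting there. *)
Definition reach mu x : R := if par G x is Some (y, b) then plan G mu y b else 1.

Lemma plan_reach mu x a : plan G mu x a = mu x a * reach mu x.
Proof.
rewrite /reach; case pE : (par G x) => [[y b]|]; first exact: plan_par.
by rewrite plan_root// mulr1.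
Qed.

Lemma plan_ge0 mu x a : is_policy G mu -> 0 <= plan G mu x a.
Proof.
move=> pmu; elim/lvl_ind: x a => [x pE|x y b pE yb IH] a.
  by rewrite plan_root//; case: (pmu x).
by rewrite (plan_par _ _ pE) mulr_ge0//; case: (pmu x).
Qed.

Lemma reach_ge0 mu x : is_policy G mu -> 0 <= reach mu x.
Proof. by move=> pmu; rewrite /reach; case: par => // -[y b]; exact: plan_ge0. Qed.

Lemma sum_plan mu x : is_policy G mu -> \sum_(a in avail G x) plan G mu x a = reach mu x.
Proof.
move=> pmu; under eq_bigr do rewrite plan_reach.
by rewrite -mulr_suml; have [_ [_ ->]] := pmu x; rewrite mul1r.
Qed.

(** Conservation of mass from layer to layer: the weight of a node is split over its actions by
    [sum_plan] and over their children by the transition. *)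
Lemma sum_seq_prob_reach q p mu h : transition q p -> is_policy G mu ->
  (1 <= h <= H)%N -> \sum_(x | lvl G x == h) seq_prob G q p x * reach mu x = 1.
Proof.
move=> [[_ p01] hp] pmu; elim: h => // -[_ _|h IH /andP[_ hH]].
  rewrite -[RHS]p01; apply: eq_bigr => x; rewrite lvl_eq1 => /eqP pE.
  by rewrite seq_prob_root// /reach pE mulr1.
rewrite sum_children// -[RHS]IH ?(ltnW hH)//; apply: eq_bigr => x /eqP xh.
rewrite -sum_plan// mulr_sumr; apply: eq_bigr => a ax.
have [_ p1] : _ /\ _ := hp x a ax (eq_ind_r (fun n => n < H)%N hH xh).
rewrite -[RHS]mul1r -[X in _ = X * _]p1 mulr_suml; apply: eq_bigr => c.
rewrite inE => /eqP pE; rewrite (seq_prob_par _ _ pE) /reach pE.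
by rewrite mulrA.
Qed.

Lemma sum_by_level (V : nmodType) (F : X -> V) :
  \sum_(1 <= h < H.+1) \sum_(x | lvl G x == h) F x = \sum_x F x.
Proof.
under eq_bigr do rewrite big_mkcond/=.
rewrite exchange_big/=; apply: eq_bigr => x _.
rewrite (bigD1_seq (lvl G x)) ?iota_uniq ?mem_index_iota ?ltnS ?lvl_bounds//=.
rewrite eqxx big1 ?addr0// => h; rewrite eq_sym => /negbTE ->; by [].
Qed.

Lemma sum_seq_prob_plan q p mu : transition q p -> is_policy G mu ->
  \sum_x \sum_(a in avail G x) seq_prob G q p x * plan G mu x a = H%:R.
Proof.
move=> tqp pmu; rewrite -sum_by_level.
under eq_big_nat => h hH.
  under eq_bigr do rewrite -mulr_sumr sum_plan//.
  rewrite sum_seq_prob_reach//; over.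
by rewrite sumr_const_nat subn1.
Qed.

Lemma seq_prob_plan_le1 q p mu x a : transition q p -> is_policy G mu ->
  a \in avail G x -> seq_prob G q p x * plan G mu x a <= 1.
Proof.
move=> tqp pmu ax.
rewrite -(sum_seq_prob_reach tqp pmu (lvl_bounds x)) (bigD1 x)//=.
rewrite -[leLHS]addr0 lerD//; last first.
  by apply: sumr_ge0 => y _; rewrite mulr_ge0 ?reach_ge0// seq_prob_ge0.
rewrite ler_wpM2l ?seq_prob_ge0// -sum_plan// (bigD1 a)//= lerDl.
by apply: sumr_ge0 => b _; exact: plan_ge0.
Qed.

(* With [S h] the sum of [Atau x * seq_prob x / pstar_seq x] over layer [h],
   layer [h] contributes exactly [S h - S h.+1], so the total telescopes to
   [S 1 = AX]. *)
Lemma balanced_sum q p : transition q p ->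
  \sum_x \sum_(a in avail G x) seq_prob G q p x / pstar_seq G x = (AX G)%:R.
Proof.
move=> [[_ q1] hp].
pose rho x : R := seq_prob G q p x / pstar_seq G x.
pose S h := \sum_(x | lvl G x == h) (Atau G x)%:R * rho x.
have stepS h : (0 < h)%N ->
    \sum_(x | lvl G x == h) \sum_(a in avail G x) rho x = - (S h.+1 - S h).
  move=> h0; rewrite opprB; apply/esym/eqP; rewrite subr_eq; apply/eqP.
  rewrite /S sum_children// -big_split/=; apply: eq_bigr => x /eqP xh.
  rewrite Atau_split natrD mulrDl sumr_const mulr_natl; congr (_ + _).
  rewrite natr_sum mulr_suml; apply: eq_bigr => a ax.
  (* Here balance enters: [pstar] is proportional to [Atau] among siblings, so [Atau G c] cancels
     and only [p x a c], which sums to [1], still depends on [c]. *)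
  have cE c : c \in children G x a -> (Atau G c)%:R * rho c =
      p x a c * ((\sum_(c in children G x a) (Atau G c)%:R) * rho x).
    rewrite inE => /eqP pE; have d0 := pstar_denom_gt0 pE.
    rewrite /rho /pstar_seq !(seq_prob_par _ _ pE) /pstar.
    have s0 := pstar_seq_gt0 x; have a0 : 0 < (Atau G c)%:R :> R by rewrite ltr0n Atau_gt0.
    rewrite /pstar_seq in s0.
    by field; rewrite !gt_eqF.
  rewrite natr_sum (eq_bigr _ cE) -mulr_suml.
  have [xH|xH] := ltnP (lvl G x) H.
    by have [_ ->] := hp _ _ ax xH; rewrite mul1r.
  rewrite [X in X * rho x]big_pred0 ?mul0r ?mulr0// => c.
  by rewrite inE; apply/negP => /eqP/par_lt_H; rewrite ltnNge xH.
rewrite -sum_by_level (eq_big_nat _ _ (F2 := fun h => - (S h.+1 - S h))); last first.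
  by move=> h /andP[h0 _]; rewrite -stepS.
rewrite sumrN telescope_sumr// opprB.
have -> : S H.+1 = 0.
  rewrite /S big_pred0// => x; apply/negbTE/eqP => xE.
  by have := lvl_bounds x; rewrite xE ltnn andbF.
rewrite subr0 -[RHS]mul1r -[X in _ = X * _]q1 mulr_suml; apply: eq_bigr => x.
rewrite lvl_eq1 => /eqP pE; rewrite /rho /pstar_seq !seq_prob_root// /pstar0.
by field; rewrite !pnatr_eq0 -!lt0n Atau_gt0 (AX_gt0 x).
Qed.

(** Realization plans form a convex set: the policy of a mixture is the mixed plan divided by the
    mixed reach. Where that reach is zero any choice gives the same plan, and [mu] is taken. *)
Lemma policy_mix mu mu' (s : R) : is_policy G mu -> is_policy G mu' -> 0 <= s <= 1 ->
  exists2 m, is_policy G m &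
    forall x a, plan G m x a = (1 - s) * plan G mu x a + s * plan G mu' x a.
Proof.
move=> pmu pmu' /andP[s0 s1]; have s1' : 0 <= 1 - s by rewrite subr_ge0.
pose r x := (1 - s) * reach mu x + s * reach mu' x.
have r0 x : 0 <= r x by rewrite addr_ge0// mulr_ge0// reach_ge0.
pose m x a := if r x == 0 then mu x a else
  ((1 - s) * plan G mu x a + s * plan G mu' x a) / r x.
have pm : is_policy G m.
  move=> x; rewrite /m; case: eqVneq => [_|rx]; first exact: pmu.
  split; [|split].
  - by move=> a; rewrite divr_ge0// addr_ge0// mulr_ge0// plan_ge0.
  - move=> a ax; rewrite !plan_reach; have [_ [-> //]] := pmu x.
    by have [_ [-> //]] := pmu' x; rewrite !mul0r !mulr0 addr0 mul0r.
  - rewrite -mulr_suml big_split/= -!mulr_sumr !sum_plan//.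
    by rewrite divff.
exists m => //.
have mE x a : m x a * r x = (1 - s) * plan G mu x a + s * plan G mu' x a.
  rewrite /m; case: (eqVneq (r x) 0) => [rx|rx]; last by rewrite divfK.
  rewrite !plan_reach rx mulr0.
  move/eqP: rx; rewrite /r paddr_eq0 ?mulr_ge0 ?reach_ge0//.
  by move=> /andP[/eqP e1 /eqP e2]; rewrite (mulrCA (1 - s)) e1 (mulrCA s) e2 !mulr0 addr0.
elim/lvl_ind => [x pE|x y b pE yb IH] a; rewrite plan_reach -mE; congr (_ * _).
  by rewrite /r /reach pE !mulr1 subrK.
by rewrite /r /reach pE IH.
Qed.

End InfoTree.

(** * Follow the regularized leader *)

(** The limit [s -> 0] made explicit. Were [a < 0], the value [s = - a / (2 * M)] would make the
    other two terms at most [- a / 2]; the summand [- a] of [M] keeps [s <= 1]. *)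
Lemma quadratic_ge0_at0 (R : realType) (a b c : R) :
  (forall s, 0 < s <= 1 -> 0 <= a + s * b + s ^+ 2 * c) -> 0 <= a.
Proof.
move=> h; rewrite leNgt; apply/negP => a0.
pose M := `|b| + `|c| + 1 - a.
have b0 := normr_ge0 b; have c0 := normr_ge0 c.
have M0 : 0 < M by rewrite /M; lra.
pose s := - a / (2 * M).
have sM : s * M = - a / 2 by rewrite /s; field; rewrite gt_eqF.
have s0 : 0 < s by rewrite divr_gt0//; lra.
have s1 : s <= 1 by rewrite ler_pdivrMr ?mulr_gt0// mul1r /M; lra.
have := h s; rewrite s0 s1 => /(_ isT).
have hb : s * b <= s * `|b| by rewrite ler_wpM2l ?ler_norm// ltW.
have hc : s ^+ 2 * c <= s * `|c|.
  apply: (@le_trans _ _ (s ^+ 2 * `|c|)); first by rewrite ler_wpM2l ?ler_norm ?sqr_ge0.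
  by rewrite ler_wpM2r// expr2 ger_pMl.
have : s * `|b| + s * `|c| <= s * M by rewrite -mulrDr ler_wpM2l ?(ltW s0)// /M; lra.
lra.
Qed.

(* First-order optimality of [w] is replaced by comparing [z] and [w] with the
   mixture [(1 - s) w + s z], where the gradient terms cancel, and letting
   [s] tend to [0]; this needs no positivity of [w]. *)
Lemma stable_minimizer (R : realType) (I : finType) (P : pred I)
    (psi dpsi : R -> R) (k0 k1 eta : R) (L g w z : I -> R) :
  stable_regularizer psi dpsi k0 k1 -> 0 < eta ->
  (forall i, P i -> [/\ 0 <= g i, 0 <= w i & 0 <= z i]) ->
  (forall s, 0 <= s <= 1 ->
     \sum_(i | P i) (w i * L i + psi (w i) / eta) <=
     \sum_(i | P i) (((1 - s) * w i + s * z i) * L i +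
                     psi ((1 - s) * w i + s * z i) / eta)) ->
  \sum_(i | P i) (w i * L i + psi (w i) / eta) + \sum_(i | P i) w i * g i
    - eta * \sum_(i | P i) g i ^+ 2 * w i * (k0 + k1 * w i) <=
  \sum_(i | P i) (z i * (L i + g i) + psi (z i) / eta).
Proof.
move=> hpsi eta0 h0 hmin; rewrite -subr_ge0.
(* The coefficients come from [v = w + s * (z - w)]: the loss term contains
   [z - v = (1 - s) * (z - w)], and [v * (k0 + k1 * v)] is expanded in powers of [s]. *)
apply: (@quadratic_ge0_at0 _ _
  (\sum_(i | P i) (- ((z i - w i) * g i) +
     eta * (g i ^+ 2 * (z i - w i) * (k0 + 2 * k1 * w i))))
  (\sum_(i | P i) (eta * (g i ^+ 2 * (z i - w i) ^+ 2 * k1)))) => s /andP[s0 s1].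
rewrite -(pmulr_rge0 _ s0).
have : 0 <= \sum_(i | P i) (((1 - s) * w i + s * z i) * L i + psi ((1 - s) * w i + s * z i) / eta) -
            \sum_(i | P i) (w i * L i + psi (w i) / eta).
  by rewrite subr_ge0; apply: hmin; rewrite (ltW s0).
move=> h; apply: le_trans h _.
rewrite -subr_ge0 !(mulr_sumr, mulrDr, mulrN, =^~ sumrN, =^~ big_split)/=.
apply: sumr_ge0 => i Pi; have [g0 w0 z0] := h0 i Pi.
set v := (1 - s) * w i + s * z i.
have v0 : 0 <= v by rewrite addr_ge0 ?mulr_ge0 ?subr_ge0 ?(ltW s0).
have key : 0 <= s * psi (z i) + (1 - s) * psi (w i) - psi v + s * (eta * g i) * (z i - v)
    + s * ((eta * g i) ^+ 2 * v * (k0 + k1 * v)).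
  (* [hpsi] requires [0 < v]. A zero mixture forces [z i = 0] and either [s = 1] or [w i = 0], and
     then both sides agree. *)
  move: v0; rewrite le_eqVlt => /predU1P[v0|v0].
    move/esym/eqP: (v0); rewrite paddr_eq0 ?mulr_ge0 ?subr_ge0 ?(ltW s0)//.
    rewrite [s * _ == _]mulf_eq0 (gt_eqF s0)/= => /andP[e1 /eqP zE].
    rewrite -v0 zE; move: e1; rewrite mulf_eq0 => /orP[/eqP s1E|/eqP ->].
      have -> : s = 1 by lra.
      by rewrite le_eqVlt; apply/orP; left; apply/eqP; ring.
    by rewrite le_eqVlt; apply/orP; left; apply/eqP; ring.
  have hz := hpsi (z i) v (eta * g i) z0 v0 (mulr_ge0 (ltW eta0) g0).
  have hw := hpsi (w i) v 0 w0 v0 (lexx _).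
  rewrite expr0n !mul0r oppr0 addr0 in hw.
  have s1' : 0 <= 1 - s by rewrite subr_ge0.
  have := lerD (ler_wpM2l (ltW s0) hz) (ler_wpM2l s1' hw).
  have -> : z i - v = (1 - s) * (z i - w i) by rewrite /v; ring.
  have -> : w i - v = - s * (z i - w i) by rewrite /v; ring.
  lra.
have e : 0 < eta^-1 by rewrite invr_gt0.
have := ler_wpM2l (ltW e) key; rewrite mulr0 => hk; apply: le_trans hk _.
rewrite le_eqVlt; apply/orP; left; apply/eqP.
by rewrite /v; field; rewrite gt_eqF.
Qed.

Section Ftrl.
Variables (R : realType) (X A : finType) (H : nat) (G : infotree X A).
Hypothesis wfG : wf_infotree H G.
Implicit Types (mu u : X -> A -> R) (l L : X -> A -> R).
Variables (psi dpsi : R -> R) (k0 k1 eta : R).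
Hypothesis hpsi : stable_regularizer psi dpsi k0 k1.
Hypothesis eta_gt0 : 0 < eta.

Definition Psi_sum mu : R :=
  \sum_(x : X) \sum_(a in avail G x) psi (pstar_seq G x * plan G mu x a).

Definition stability mu l : R :=
  \sum_(x : X) \sum_(a in avail G x)
    (l x a / pstar_seq G x) ^+ 2 * (pstar_seq G x * plan G mu x a) *
    (k0 + k1 * (pstar_seq G x * plan G mu x a)).

Lemma ftrl_objE L mu :
  ftrl_obj H G psi (fun=> eta) L mu = ip G mu L + Psi_sum mu / eta.
Proof.
rewrite /ftrl_obj -mulr_suml; congr (_ + _ / _).
exact: sum_by_level wfG _ _.
Qed.

Lemma ipD mu L l : ip G mu (fun x a => L x a + l x a) = ip G mu L + ip G mu l.
Proof.
rewrite /ip -big_split/=; apply: eq_bigr => x _.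
by rewrite -big_split/=; apply: eq_bigr => a _; rewrite mulrDr.
Qed.

(** In the coordinates [w = pstar * plan] the loss becomes [l / pstar], the regularizer separates,
    and the feasible set is convex by [policy_mix]; [stable_minimizer] then applies. *)
Lemma ftrl_step L l mu u : is_policy G mu -> is_policy G u ->
  (forall mu', is_policy G mu' ->
     ftrl_obj H G psi (fun=> eta) L mu <= ftrl_obj H G psi (fun=> eta) L mu') ->
  (forall x a, 0 <= l x a) ->
  ip G mu L + Psi_sum mu / eta + ip G mu l - eta * stability mu l <=
  ip G u L + ip G u l + Psi_sum u / eta.
Proof.
move=> pmu pu hmin l0.
pose w m (i : X * A) := pstar_seq G i.1 * plan G m i.1 i.2 : R.
pose P (i : X * A) := i.2 \in avail G i.1.
have ps0 x : 0 < pstar_seq G x :> R by exact: pstar_seq_gt0 wfG x.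
have ipE m K : ip G m K = \sum_(i | P i) w m i * (K i.1 i.2 / pstar_seq G i.1).
  rewrite /ip pair_big_dep/=; apply: eq_bigr => i _.
  by rewrite /w; field; rewrite gt_eqF.
have PsiE m : Psi_sum m / eta = \sum_(i | P i) psi (w m i) / eta.
  by rewrite /Psi_sum pair_big_dep/= mulr_suml.
have := @stable_minimizer R _ P psi dpsi k0 k1 eta
  (fun i => L i.1 i.2 / pstar_seq G i.1) (fun i => l i.1 i.2 / pstar_seq G i.1)
  (w mu) (w u) hpsi eta_gt0.
rewrite big_split/= -ipE -PsiE -ipE.
rewrite /stability pair_big_dep/= => h; apply: le_trans (h _ _) _.
- move=> i _; split; rewrite /w.
  + by rewrite divr_ge0// ltW.
  + by rewrite mulr_ge0 ?(plan_ge0 wfG)// ltW.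
  + by rewrite mulr_ge0 ?(plan_ge0 wfG)// ltW.
- move=> s s01; have [m pm mE] := policy_mix wfG pmu pu s01.
  have := hmin m pm; rewrite !ftrl_objE => h'; apply: le_trans h' _.
  rewrite ipE PsiE -big_split/=.
  rewrite le_eqVlt; apply/orP; left; apply/eqP; apply: eq_bigr => i _.
  have -> : w m i = (1 - s) * w mu i + s * w u i by rewrite /w mE; ring.
  by [].
rewrite -ipD ipE PsiE -big_split/=.
rewrite le_eqVlt; apply/orP; left; apply/eqP; apply: eq_bigr => i _.
by rewrite mulrDl.
Qed.

Lemma ftrl_regret (T : nat) (l : nat -> X -> A -> R) (mus : nat -> X -> A -> R) u :
  (1 <= T)%N -> (forall t, (1 <= t <= T)%N -> forall x a, 0 <= l t x a) ->
  (forall t, (1 <= t <= T)%N -> is_policy G (mus t) /\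
     forall mu', is_policy G mu' ->
       ftrl_obj H G psi (fun=> eta) (fun x a => \sum_(1 <= k < t) l k x a) (mus t) <=
       ftrl_obj H G psi (fun=> eta) (fun x a => \sum_(1 <= k < t) l k x a) mu') ->
  is_policy G u ->
  \sum_(1 <= t < T.+1) (ip G (mus t) (l t) - ip G u (l t)) <=
  (Psi_sum u - Psi_sum (mus 1%N)) / eta + eta * \sum_(1 <= t < T.+1) stability (mus t) (l t).
Proof.
move=> T1 l0 hmu pu.
pose Lt n := fun x a => \sum_(1 <= k < n) l k x a.
have LtS n : (0 < n)%N -> Lt n.+1 = (fun x a => Lt n x a + l n x a).
  by move=> n0; apply/funext => x; apply/funext => a; rewrite /Lt big_nat_recr.
have ip0 m : ip G m (Lt 1%N) = 0.
  by rewrite /ip big1// => x _; rewrite big1// => a _; rewrite /Lt big_geq// mulr0.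
(* The comparator stays quantified because the step applies the induction hypothesis to the next
   leader [mus n.+1]. *)
have main n : (n <= T)%N -> forall v, is_policy G v ->
    Psi_sum (mus 1%N) / eta + \sum_(1 <= t < n.+1) (ip G (mus t) (l t) - eta * stability (mus t) (l t))
    <= ip G v (Lt n.+1) + Psi_sum v / eta.
  elim: n => [_ v pv|n IH nT v pv].
    have [_ /(_ v pv)] := hmu 1%N T1.
    by rewrite !ftrl_objE -/(Lt 1%N) !ip0 !add0r big_geq// addr0.
  have [pm hm] := hmu n.+1 nT.
  rewrite big_nat_recr//= LtS// ipD.
  apply: le_trans (ftrl_step pm pv hm (l0 n.+1 nT)).
  have := IH (ltnW nT) _ pm; rewrite -/(Lt n.+1); lra.
have := main T (leqnn T) u pu.
have -> : ip G u (Lt T.+1) = \sum_(1 <= t < T.+1) ip G u (l t).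
  elim: {T1 l0 hmu main} T => [|n IH]; first by rewrite ip0 big_geq.
  by rewrite LtS// ipD IH [RHS]big_nat_recr.
rewrite !sumrB -mulr_sumr mulrBl; lra.
Qed.

End Ftrl.

(** * Conditional expectations and exponential supermartingales *)

Section BoundedMeasurable.
Context {R : realType} {d : measure_display} {T : measurableType d}.
Implicit Types f g : T -> R.

(** A class closed under the operations below and integrable for every probability. It is stated
    over an arbitrary measurable type so that [sub_meas] inherits the closure lemmas with
    [g_sigma_algebraType F] as source. *)
Definition bounded_meas f :=
  measurable_fun setT f /\ exists K : R, forall w, `|f w| <= K.

Lemma bounded_meas_cst (c : R) : bounded_meas (fun=> c).
Proof. by split; [exact: measurable_cst|exists `|c|]. Qed.

Lemma bounded_measD f g : bounded_meas f -> bounded_meas g ->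
  bounded_meas (fun w => f w + g w).
Proof.
move=> [mf [K fK]] [mg [M gM]]; split; first exact: measurable_funD.
by exists (K + M) => w; rewrite (le_trans (ler_normD _ _))// lerD.
Qed.

Lemma bounded_measM f g : bounded_meas f -> bounded_meas g ->
  bounded_meas (fun w => f w * g w).
Proof.
move=> [mf [K fK]] [mg [M gM]]; split; first exact: measurable_funM.
by exists (K * M) => w; rewrite normrM ler_pM.
Qed.

Lemma bounded_measN f : bounded_meas f -> bounded_meas (fun w => - f w).
Proof.
move=> bf; have := bounded_measM (bounded_meas_cst (-1)) bf.
by congr bounded_meas; apply/funext => w; rewrite mulN1r.
Qed.

Lemma bounded_measB f g : bounded_meas f -> bounded_meas g ->
  bounded_meas (fun w => f w - g w).
Proof. by move=> bf bg; apply: bounded_measD => //; exact: bounded_measN. Qed.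

Lemma bounded_meas_sum (I : Type) (s : seq I) (P : pred I) (f : I -> T -> R) :
  (forall i, P i -> bounded_meas (f i)) ->
  bounded_meas (fun w => \sum_(i <- s | P i) f i w).
Proof.
move=> bf; elim: s => [|i s IH].
  rewrite (_ : (fun w => \sum_(i <- [::] | P i) f i w) = fun=> 0); first exact: bounded_meas_cst.
  by apply/funext => w; rewrite big_nil.
rewrite (_ : (fun w => \sum_(j <- i :: s | P j) f j w) = fun w => if P i then f i w + \sum_(j <- s | P j) f j w
  else \sum_(j <- s | P j) f j w); last by apply/funext => w; rewrite big_cons.
by case Pi : (P i) => //; apply: bounded_measD => //; exact: bf.
Qed.

Lemma bounded_meas_expR f : bounded_meas f -> bounded_meas (fun w => expR (f w)).
Proof.
move=> [mf [K fK]]; split; first exact: measurableT_comp.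
exists (expR K) => w; rewrite ger0_norm ?expR_ge0// ler_expR.
exact: le_trans (ler_norm _) (fK w).
Qed.

Lemma bounded_meas_inv f (c : R) : 0 < c -> (forall w, c <= f w) ->
  measurable_fun setT f -> bounded_meas (fun w => (f w)^-1).
Proof.
move=> c0 cf mf; split.
  have -> : (fun w => (f w)^-1) = (fun w => f w `^ (-1)).
    by apply/funext => w; rewrite powR_inv1// (le_trans (ltW c0)).
  by apply: (measurableT_comp (measurable_powR (-1))).
exists c^-1 => w; have f0 := lt_le_trans c0 (cf w).
by rewrite ger0_norm ?invr_ge0 ?(ltW f0)// lef_pV2.
Qed.

Lemma bounded_meas_if (b : T -> bool) f g : measurable_fun setT b ->
  bounded_meas f -> bounded_meas g ->
  bounded_meas (fun w => if b w then f w else g w).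
Proof.
move=> mb [mf [K fK]] [mg [M gM]]; split; first exact: measurable_fun_ifT.
exists (Num.max K M) => w; rewrite le_max.
by case: (b w); rewrite ?fK ?gM ?orbT.
Qed.

Lemma bounded_meas_integrable (P : probability T R) f :
  bounded_meas f -> P.-integrable setT (EFin \o f).
Proof.
move=> [mf [K fK]]; apply: measurable_bounded_integrable => //.
  by rewrite [ltLHS]probability_setT ltry.
by exists K; split; [exact: num_real|move=> x Kx w _; exact: le_trans (fK w) (ltW Kx)].
Qed.

End BoundedMeasurable.

Section SubSigmaAlgebra.
Context {R : realType} {d : measure_display} {Omega : measurableType d}.
Implicit Types (F : set (set Omega)) (f : Omega -> R).

Definition sub_meas F f := @bounded_meas R _ (g_sigma_algebraType F) f.

Lemma g_sigma_measurable F (B : set Omega) : sigma_algebra setT F ->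
  @measurable _ (g_sigma_algebraType F) B = F B.
Proof. by move=> sF; rewrite /measurable/= sigma_algebra_id. Qed.

Lemma sub_measS F F' f : (F `<=` F')%classic -> sub_meas F f -> sub_meas F' f.
Proof.
move=> FF' [mf bf]; split=> // _ B mB; have := mf measurableT B mB.
exact: sub_sigma_algebra2.
Qed.

Lemma sub_meas_bounded F f : sigma_algebra setT F -> (F `<=` measurable)%classic ->
  sub_meas F f -> bounded_meas f.
Proof.
move=> sF FM [mf bf]; split=> // _ B mB; have := mf measurableT B mB.
by rewrite g_sigma_measurable// => /FM.
Qed.

Lemma F_meas_realP F f : sigma_algebra setT F -> F_meas_real F f ->
  @measurable_fun _ _ (g_sigma_algebraType F) R setT f.
Proof.
move=> sF mf; apply: (@measurability _ _ (g_sigma_algebraType F) _ setT f _ (RGenOInfty.measurableE R)).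
move=> _ [_ [c ->] <-]; rewrite setTI g_sigma_measurable//.
have -> : (f @^-1` `]c, +oo[ = ~` [set w | f w <= c])%classic.
  apply/seteqP; split => w /=; rewrite in_itv/= andbT ltNge; first by move/negP.
  by move/negP.
by rewrite -g_sigma_measurable//; apply: measurableC; rewrite g_sigma_measurable.
Qed.

Lemma F_meas_finP (V : finType) F (f : Omega -> V) (v : V) : sigma_algebra setT F ->
  F_meas_fin F f ->
  @measurable_fun _ _ (g_sigma_algebraType F) bool setT (fun w => f w == v).
Proof.
move=> sF mf; apply: (@measurable_fun_bool _ (g_sigma_algebraType F) _ _ true).
rewrite setTI g_sigma_measurable//.
have -> : ((fun w => f w == v) @^-1` [set true] = [set w | f w = v])%classic => //.
by apply/seteqP; split => w /= /eqP.
Qed.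

End SubSigmaAlgebra.

Section Expectation.
Context {R : realType} {d : measure_display} {Omega : measurableType d}.
Variable P : probability Omega R.
Implicit Types (F : set (set Omega)) (f g W Y Z : Omega -> R).

Definition E f : R := \int[P]_w f w.

Lemma ED f g : bounded_meas f -> bounded_meas g -> E (fun w => f w + g w) = E f + E g.
Proof. by move=> bf bg; apply: RintegralD => //; exact: bounded_meas_integrable. Qed.

Lemma EB f g : bounded_meas f -> bounded_meas g -> E (fun w => f w - g w) = E f - E g.
Proof. by move=> bf bg; apply: RintegralB => //; exact: bounded_meas_integrable. Qed.

Lemma EZ (c : R) f : bounded_meas f -> E (fun w => c * f w) = c * E f.
Proof. by move=> bf; apply: RintegralZl => //; exact: bounded_meas_integrable. Qed.

Lemma E_cst (c : R) : E (fun=> c) = c.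
Proof. by rewrite /E Rintegral_cst//= probability_setT mulr1. Qed.

Lemma le_E f g : bounded_meas f -> bounded_meas g -> (forall w, f w <= g w) -> E f <= E g.
Proof. by move=> bf bg fg; apply: le_Rintegral => //; exact: bounded_meas_integrable. Qed.

Lemma E_sum (I : finType) (Q : pred I) (f : I -> Omega -> R) :
  (forall i, Q i -> bounded_meas (f i)) ->
  E (fun w => \sum_(i | Q i) f i w) = \sum_(i | Q i) E (f i).
Proof.
move=> bf; elim: (index_enum I) => [|i s IH].
  by rewrite big_nil -[RHS](E_cst 0); congr E; apply/funext => w; rewrite big_nil.
rewrite big_cons; case Qi : (Q i); last first.
  by rewrite -IH; congr E; apply/funext => w; rewrite big_cons Qi.
rewrite -IH -ED; [|exact: bf|exact: bounded_meas_sum].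
by congr E; apply/funext => w; rewrite big_cons Qi.
Qed.

Lemma Rintegral_patch (B : set Omega) f :
  \int[P]_(w in B) f w = E (fun w => (w \in B)%:R * f w).
Proof.
rewrite Rintegral_mkcond; congr E; apply/funext => w; rewrite patchE.
by case: ifP => _; rewrite ?mul1r ?mul0r.
Qed.

(* Two bounded variables with the same conditional expectation given [F]. *)
Definition cond_eq F Y Z :=
  forall W, sub_meas F W -> (forall w, 0 <= W w) ->
    E (fun w => W w * Y w) = E (fun w => W w * Z w).

Lemma bounded_meas_indic (B : set Omega) : measurable B ->
  bounded_meas (fun w => (w \in B)%:R : R).
Proof.
move=> mB; split; first exact: measurable_indic.
by exists 1 => w; case: (w \in B); rewrite ?normr1 ?normr0.
Qed.

(* [W] is peeled off in steps of height [e]: subtracting [e] on [{e <= W}]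
   lowers the supremum by [e] and does not change [E (W * D)]. *)
Lemma cond_eq_integral F Y Z : sigma_algebra setT F -> (F `<=` measurable)%classic ->
  bounded_meas Y -> bounded_meas Z ->
  (forall B, F B -> (\int[P]_(w in B) (Y w)%:E = \int[P]_(w in B) (Z w)%:E)%E) ->
  cond_eq F Y Z.
Proof.
move=> sF FM bY bZ YZ.
pose D w := Y w - Z w; have bD : bounded_meas D by exact: bounded_measB.
have [K DK] := bD.2.
have K0 : 0 <= K by apply: le_trans (DK point); rewrite normr_ge0.
have DB B : F B -> E (fun w => (w \in B)%:R * D w) = 0.
  move=> FB; rewrite -Rintegral_patch RintegralB.
  - by rewrite /Rintegral YZ// subrr.
  - exact: FM.
  - by apply: integrableS (bounded_meas_integrable P bY) => //; exact: FM.
  - by apply: integrableS (bounded_meas_integrable P bZ) => //; exact: FM.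
(* The bound does not depend on [n]: peeling leaves the expectation unchanged until a single layer
   of height [e] remains, which contributes at most [e * K]. *)
have small (e : R) n W : 0 <= e -> sub_meas F W -> (forall w, 0 <= W w <= n.+1%:R * e) ->
    `|E (fun w => W w * D w)| <= e * K.
  move=> e0; elim: n W => [|n IH] W mW hW.
    have bWD : bounded_meas (fun w => W w * D w).
      by apply: bounded_measM => //; exact: sub_meas_bounded mW.
    rewrite ler_norml -[X in X <= _ <= _]E_cst -[X in _ <= _ <= X]E_cst !le_E//;
      try exact: bounded_meas_cst; move=> w.
      by have := hW w; rewrite mul1r => /andP[W0 We]; have := DK w; rewrite ler_norml => /andP[]; nra.
    by have := hW w; rewrite mul1r => /andP[W0 We]; have := DK w; rewrite ler_norml => /andP[]; nra.
  pose B := [set w | e <= W w]%classic.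
  have FB : F B.
    rewrite -g_sigma_measurable//.
    have := @measurable_fun_ler _ (g_sigma_algebraType F) R setT (cst e) W (measurable_cst _) mW.1.
    move=> /(_ measurableT [set true]%classic); rewrite setTI => /(_ _).
    exact.
  pose W' w := W w - e * (w \in B)%:R.
  have mI : sub_meas F (fun w => (w \in B)%:R : R).
    split; last by exists 1 => w; case: (w \in B); rewrite ?normr1 ?normr0.
    by apply: (@measurable_indic _ (g_sigma_algebraType F)); rewrite g_sigma_measurable.
  have mW' : sub_meas F W'.
    apply: (@bounded_measB _ _ (g_sigma_algebraType F)) => //.
    by apply: (@bounded_measM _ _ (g_sigma_algebraType F)) => //; exact: bounded_meas_cst.
  suff -> : E (fun w => W w * D w) = E (fun w => W' w * D w).
    apply: IH => // w; rewrite /W'; have /andP[W0 We] := hW w.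
    have [/set_mem/= eW|] := boolP (w \in B).
      by rewrite mulr1 subr_ge0 eW/= lerBlDr -natr1 mulrDl mul1r in We *.
    rewrite mulr0 subr0 W0/= => /negP wB.
    have eW : W w < e by rewrite ltNge; apply/negP => eW; apply: wB; exact/mem_set.
    by rewrite (le_trans (ltW eW))// ler_peMl// ler1n.
  have bB : bounded_meas (fun w => (w \in B)%:R : R) by exact: bounded_meas_indic (FM _ FB).
  rewrite -[LHS]subr0 -[X in _ - X](mulr0 e) -(DB B FB) -EZ; last exact: bounded_measM.
  rewrite -EB.
  - by congr E; apply/funext => w; rewrite /W'; ring.
  - by apply: bounded_measM => //; exact: sub_meas_bounded mW.
  - by apply: bounded_measM; [exact: bounded_meas_cst|exact: bounded_measM].
move=> W mW W0.
have bW : bounded_meas W by exact: sub_meas_bounded mW.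
apply/eqP; rewrite -subr_eq0 -EB; try exact: bounded_measM.
have -> : (fun w => W w * Y w - W w * Z w) = (fun w => W w * D w).
  by apply/funext => w; rewrite /D mulrBr.
have [C WC] := mW.2.
have C0 : 0 <= C by apply: le_trans (WC point); rewrite normr_ge0.
rewrite -normr_eq0 eq_le normr_ge0 andbT; apply/ler_addgt0Pl => eps eps0.
rewrite addr0.
pose n := Num.bound (C * K / eps).
have nE : C * K / eps < n.+1%:R.
  apply: lt_le_trans (_ : n%:R <= _); last by rewrite ler_nat.
  by apply: archi_boundP; rewrite divr_ge0 ?mulr_ge0// ltW.
apply: le_trans (small (C / n.+1%:R) n W _ mW _) _.
- by rewrite divr_ge0.
- move=> w; rewrite W0/= mulrC divfK ?pnatr_eq0//.
  by rewrite (le_trans (ler_norm _)).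
- rewrite mulrAC ler_pdivrMr ?ltr0n// [eps * _]mulrC -ler_pdivrMr//.
  exact: ltW.
Qed.

Lemma cond_eqZ F V Y Z : sub_meas F V -> (forall w, 0 <= V w) ->
  cond_eq F Y Z -> cond_eq F (fun w => V w * Y w) (fun w => V w * Z w).
Proof.
move=> mV V0 YZ W mW W0.
have mulA Y' : (fun w => W w * (V w * Y' w)) = (fun w => W w * V w * Y' w).
  by apply/funext => w; rewrite mulrA.
rewrite !mulA; apply: YZ.
- exact: (@bounded_measM _ _ (g_sigma_algebraType F)).
- by move=> w; rewrite mulr_ge0.
Qed.

Lemma cond_eq_sum F (I : finType) (Q : pred I) (Y Z : I -> Omega -> R) :
  sigma_algebra setT F -> (F `<=` measurable)%classic ->
  (forall i, Q i -> [/\ bounded_meas (Y i), bounded_meas (Z i) & cond_eq F (Y i) (Z i)]) ->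
  cond_eq F (fun w => \sum_(i | Q i) Y i w) (fun w => \sum_(i | Q i) Z i w).
Proof.
move=> sF FM h W mW W0; have bW : bounded_meas W by exact: sub_meas_bounded mW.
rewrite (_ : (fun w => _) = (fun w => \sum_(i | Q i) W w * Y i w)); last first.
  by apply/funext => w; rewrite mulr_sumr.
rewrite (_ : (fun w => W w * _) = (fun w => \sum_(i | Q i) W w * Z i w)); last first.
  by apply/funext => w; rewrite mulr_sumr.
rewrite !E_sum; [|by move=> i /h[? ? _]; exact: bounded_measM..].
by apply: eq_bigr => i /h[_ _]; exact.
Qed.

(** The inequality [E[exp S | F] <= 1], tested against nonnegative bounded [F]-measurable weights in
    place of a conditional expectation. *)
Definition exp_supermart F S :=
  forall W, sub_meas F W -> (forall w, 0 <= W w) ->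
    E (fun w => W w * expR (S w)) <= E W.

(** Convexity bounds the exponential by an affine function of [Y], so that conditioning replaces [Y]
    by [mu * l]; [ix_weight_le] then leaves [1 + 2 * g * l <= exp (2 * g * l)], which the
    compensator cancels. *)
Lemma ix_supermart F (mu l Y : Omega -> R) (g : R) :
  sigma_algebra setT F -> (F `<=` measurable)%classic -> 0 < g ->
  sub_meas F mu -> (forall w, 0 <= mu w) -> sub_meas F l -> (forall w, 0 <= l w) ->
  bounded_meas Y -> (forall w, 0 <= Y w <= 1) ->
  cond_eq F Y (fun w => mu w * l w) ->
  exp_supermart F (fun w => 2 * g * (Y w / (mu w + g) - l w)).
Proof.
move=> sF FM g0 mmu mu0 ml l0 bY Y01 hY W mW W0.
pose sF' := g_sigma_algebraType F.
have bC c : sub_meas F (fun=> c : R) by exact: bounded_meas_cst.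
have bM f1 f2 : sub_meas F f1 -> sub_meas F f2 -> sub_meas F (fun w => f1 w * f2 w).
  exact: (@bounded_measM _ _ sF').
have bS f1 : sub_meas F f1 -> bounded_meas f1 by exact: sub_meas_bounded.
have mI : sub_meas F (fun w => (mu w + g)^-1).
  apply: (@bounded_meas_inv _ _ sF' _ g) => //; first by move=> w; rewrite lerDr.
  exact: (@bounded_measD _ _ sF' _ _ mmu (bC g)).1.
pose D w := expR (2 * g / (mu w + g)) - 1.
have mD : sub_meas F D.
  apply: (@bounded_measB _ _ sF') (bC 1); apply: (@bounded_meas_expR _ _ sF').
  exact: bM.
have D0 w : 0 <= D w.
  by rewrite subr_ge0 -expR0 ler_expR divr_ge0 ?addr_ge0 ?mulr_ge0// ltW.
pose W1 w := W w * expR (- (2 * g) * l w).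
have mW1 : sub_meas F W1.
  by apply: (bM) => //; apply: (@bounded_meas_expR _ _ sF'); exact: bM.
have W10 w : 0 <= W1 w by rewrite mulr_ge0 ?expR_ge0.
have mWD : sub_meas F (fun w => W1 w * D w) by exact: bM.
apply: (@le_trans _ _ (E (fun w => W1 w + W1 w * D w * Y w))).
  apply: le_E.
  - apply: bounded_measM; first exact: bS.
    apply: bounded_meas_expR; apply: bounded_measM; first exact: bS.
    by apply: bounded_measB; [apply: bounded_measM => //|]; exact: bS.
  - by apply: bounded_measD; [exact: bS|apply: bounded_measM => //; exact: bS].
  - move=> w; have := ix_moment_le (mu0 w) g0 (Y01 w) => h.
    rewrite (_ : 2 * g * (Y w / (mu w + g) - l w) =
      - (2 * g) * l w + 2 * g * (Y w / (mu w + g))); last by ring.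
    rewrite expRD mulrA -/(W1 w).
    rewrite (_ : W1 w + W1 w * D w * Y w = W1 w * (1 + Y w * D w)); last by ring.
    by rewrite ler_wpM2l.
rewrite ED; [|exact: bS|by apply: bounded_measM => //; exact: bS].
rewrite hY//; last by move=> w; rewrite mulr_ge0.
rewrite -ED; [|exact: bS|by apply: bS; apply: (bM) => //; exact: bM].
apply: le_E.
- by apply: bS; apply: (@bounded_measD _ _ sF') => //; apply: (bM) => //; exact: bM.
- exact: bS.
move=> w; have h := ix_weight_le (mu0 w) g0.
have h1 : W1 w + W1 w * D w * (mu w * l w) <= W1 w * (1 + 2 * g * l w).
  rewrite (_ : _ + _ = W1 w * (1 + mu w * D w * l w)); last by ring.
  by rewrite ler_wpM2l// lerD2l ler_wpM2r.
apply: le_trans h1 _; rewrite -[leRHS]mulr1 /W1 -mulrA ler_wpM2l//.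
rewrite -[leRHS](expR0 R) -(addNr (2 * g * l w)) expRD mulNr ler_wpM2l ?expR_ge0//.
exact: expR_ge1Dx.
Qed.

(** For the lower tail, [0 <= S <= h] gives [exp (- lam * S) <= 1 - lam * S + (lam * h) ^ 2 / 2],
    affine in [S], so conditioning replaces [S] by [m]; the quadratic term is the compensator. *)
Lemma lower_supermart F (S m : Omega -> R) (lam h : R) :
  sigma_algebra setT F -> (F `<=` measurable)%classic -> 0 <= lam ->
  bounded_meas S -> sub_meas F m -> (forall w, 0 <= S w <= h) ->
  cond_eq F S m ->
  exp_supermart F (fun w => lam * (m w - S w) - (lam * h) ^+ 2 / 2).
Proof.
move=> sF FM lam0 bS mm Sh hS W mW W0.
pose sF' := g_sigma_algebraType F.
have bC c : sub_meas F (fun=> c : R) by exact: bounded_meas_cst.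
have bM f1 f2 : sub_meas F f1 -> sub_meas F f2 -> sub_meas F (fun w => f1 w * f2 w).
  exact: (@bounded_measM _ _ sF').
have bb f1 : sub_meas F f1 -> bounded_meas f1 by exact: sub_meas_bounded.
pose k := 1 + (lam * h) ^+ 2 / 2.
pose W1 w := W w * expR (lam * m w - (lam * h) ^+ 2 / 2).
have mW1 : sub_meas F W1.
  apply: (bM) => //; apply: (@bounded_meas_expR _ _ sF').
  by apply: (@bounded_measB _ _ sF'); [exact: bM|exact: bC].
have W10 w : 0 <= W1 w by rewrite mulr_ge0 ?expR_ge0.
have bW1S : bounded_meas (fun w => W1 w * S w) by apply: bounded_measM => //; exact: bb.
have bkW : bounded_meas (fun w => k * W1 w) by apply: bounded_measM; [exact: bounded_meas_cst|exact: bb].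
have blWS : bounded_meas (fun w => lam * (W1 w * S w)).
  by apply: bounded_measM; [exact: bounded_meas_cst|].
apply: (@le_trans _ _ (E (fun w => k * W1 w - lam * (W1 w * S w)))).
  apply: le_E => //.
  - apply: bounded_measM; first exact: bb.
    apply: bounded_meas_expR; apply: bounded_measB; last exact: bounded_meas_cst.
    apply: bounded_measM; first exact: bounded_meas_cst.
    by apply: bounded_measB => //; exact: bb.
  - exact: bounded_measB.
  - move=> w; have /andP[S0 S1] := Sh w.
    have hq := expRN_le_quadratic (mulr_ge0 lam0 S0).
    have hs : (lam * S w) ^+ 2 <= (lam * h) ^+ 2.
      by rewrite lerXn2r ?nnegrE ?ler_wpM2l ?mulr_ge0// (le_trans S0).
    rewrite (_ : lam * (m w - S w) - (lam * h) ^+ 2 / 2 =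
      (lam * m w - (lam * h) ^+ 2 / 2) + - (lam * S w)); last by ring.
    rewrite expRD mulrA -/(W1 w).
    rewrite (_ : k * W1 w - lam * (W1 w * S w) = W1 w * (k - lam * S w)); last by ring.
    by rewrite ler_wpM2l// (le_trans hq)// /k; lra.
rewrite EB// [X in _ - X]EZ// hS// -[X in _ - X]EZ; last by apply: (bb); exact: bM.
have blWm : sub_meas F (fun w => lam * (W1 w * m w)) by apply: (bM) => //; exact: bM.
rewrite -EB//; last exact: bb.
apply: le_E; [apply: bounded_measB => //; exact: bb|exact: bb|move=> w].
rewrite (_ : k * W1 w - lam * (W1 w * m w) = W1 w * (k - lam * m w)); last by ring.
rewrite -[leRHS]mulr1 /W1 -mulrA ler_wpM2l//.
set z := lam * m w - _.
apply: (@le_trans _ _ (expR z * expR (- z))); last by rewrite -expRD subrr expR0.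
by rewrite ler_wpM2l ?expR_ge0//; have := expR_ge1Dx (- z); rewrite /k /z; lra.
Qed.

(** Testing each step against the exponential of the preceding partial sum shows by induction that
    the exponential of the whole sum has mean at most [1]; Markov's inequality gives the tail. *)
Lemma exp_supermart_tail (F : nat -> set (set Omega)) (T : nat) (S : nat -> Omega -> R) (c : R) :
  (forall t, sigma_algebra setT (F t)) -> (forall t, (F t `<=` measurable)%classic) ->
  (forall t, (F t `<=` F t.+1)%classic) ->
  (forall t, (1 <= t <= T)%N -> sub_meas (F t) (S t)) ->
  (forall t, (1 <= t <= T)%N -> exp_supermart (F t.-1) (S t)) ->
  measurable [set w | c < \sum_(1 <= t < T.+1) S t w]%classic /\
  (P [set w | (c < \sum_(1 <= t < T.+1) S t w)%R]%classic <= (expR (- c))%:E)%E.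
Proof.
move=> sF FM FS mS hS.
have mSum n : (n <= T)%N -> sub_meas (F n) (fun w => \sum_(1 <= t < n.+1) S t w).
  elim: n => [_|n IH nT].
    rewrite (_ : (fun w => _) = fun=> 0); first exact: bounded_meas_cst.
    by apply/funext => w; rewrite big_geq.
  rewrite (_ : (fun w => _) = fun w => \sum_(1 <= t < n.+1) S t w + S n.+1 w); last first.
    by apply/funext => w; rewrite [LHS]big_nat_recr.
  apply: (@bounded_measD _ _ (g_sigma_algebraType (F n.+1))); last exact: mS.
  exact: sub_measS (FS n) (IH (ltnW nT)).
have main n : (n <= T)%N -> E (fun w => expR (\sum_(1 <= t < n.+1) S t w)) <= 1.
  elim: n => [_|n IH nT].
    rewrite -[leRHS](E_cst 1) le_eqVlt; apply/orP; left; apply/eqP; congr E.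
    by apply/funext => w; rewrite big_geq// expR0.
  apply: le_trans (IH (ltnW nT)).
  have := hS n.+1 nT (fun w => expR (\sum_(1 <= t < n.+1) S t w)).
  rewrite (_ : (fun w => _ * _) = fun w => expR (\sum_(1 <= t < n.+2) S t w)); last first.
    by apply/funext => w; rewrite [in RHS]big_nat_recr//= expRD.
  apply; last by move=> w; exact: expR_ge0.
  by apply: (@bounded_meas_expR _ _ (g_sigma_algebraType (F n))); exact: mSum (ltnW nT).
have bT : bounded_meas (fun w => \sum_(1 <= t < T.+1) S t w).
  exact: sub_meas_bounded (sF _) (FM _) (mSum T (leqnn T)).
set B := [set w | _]%classic.
have mB : measurable B.
  have := @measurable_fun_ltr _ Omega R setT (cst c) _ (measurable_cst _) bT.1.
  move=> /(_ measurableT [set true]%classic); rewrite setTI => /(_ _).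
  exact.
split=> //.
have h : E (fun w => expR c * (w \in B)%:R) <= 1.
  apply: le_trans (main T (leqnn T)); apply: le_E.
  - by apply: bounded_measM; [exact: bounded_meas_cst|exact: bounded_meas_indic].
  - exact: bounded_meas_expR.
  - move=> w; have [/set_mem/= cS|_] := boolP (w \in B).
      by rewrite mulr1 ler_expR ltW.
    by rewrite mulr0 expR_ge0.
rewrite EZ in h; last exact: bounded_meas_indic.
have PE : P B = (E (fun w => (w \in B)%:R))%:E.
  rewrite /E /Rintegral fineK; first by rewrite integral_indic// setIT.
  have := bounded_meas_integrable P (bounded_meas_indic mB).
  exact: integrable_fin_num.
by rewrite PE lee_fin expRN -[leRHS]mul1r ler_pdivlMr ?expR_gt0// mulrC.
Qed.

End Expectation.

(** * Regret decomposition *)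

Section Deterministic.
Variables (R : realType) (X A : finType) (H : nat) (G : infotree X A).
Hypothesis wfG : wf_infotree H G.
Variables (Nu : Type) (p0 : Nu -> X -> R) (ptr : Nu -> X -> A -> X -> R)
  (rw : Nu -> X -> A -> R).
Hypothesis wfo : wf_opponent H G p0 ptr rw.
Implicit Types (mu : X -> A -> R) (nu : Nu).

Definition playable (i : X * A) := i.2 \in avail G i.1.

Lemma sum_playable (V : nmodType) (f : X -> A -> V) :
  \sum_x \sum_(a in avail G x) f x a = \sum_(i | playable i) f i.1 i.2.
Proof. by rewrite pair_big_dep. Qed.

Lemma card_playable : #|playable| = AX G.
Proof.
rewrite -sum1_card AXE.
under [RHS]eq_bigr do rewrite -sum1_card.
by rewrite pair_big_dep.
Qed.

Lemma opponent_transition nu : transition H G (p0 nu) (ptr nu).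
Proof.
have [[h1 [_ h2]] [h3 _]] := wfo nu; split=> // x a ax xH.
by have [? [_ ?]] := h3 x a ax xH.
Qed.

Lemma loss_ge0 nu x a : 0 <= loss G p0 ptr rw nu x a.
Proof.
have [_ [_ /(_ x a) /andP[_ r1]]] := wfo nu.
by rewrite mulr_ge0 ?subr_ge0//; apply: (seq_prob_ge0 wfG); exact: opponent_transition.
Qed.

Lemma loss_le nu x a : loss G p0 ptr rw nu x a <= seq_prob G (p0 nu) (ptr nu) x.
Proof.
have [_ [_ /(_ x a) /andP[r0 _]]] := wfo nu.
rewrite /loss ler_piMr ?gerBl//.
apply: (seq_prob_ge0 wfG); exact: opponent_transition.
Qed.

Lemma sum_loss_pstar_le nu :
  \sum_(i | playable i) loss G p0 ptr rw nu i.1 i.2 / pstar_seq G i.1 <= (AX G)%:R.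
Proof.
rewrite -(balanced_sum wfG (opponent_transition nu)) sum_playable.
apply: ler_sum => i _; rewrite ler_wpM2r ?loss_le// invr_ge0 ltW//.
exact: pstar_seq_gt0 wfG _.
Qed.

Lemma ip_loss_le mu nu : is_policy G mu -> ip G mu (loss G p0 ptr rw nu) <= H%:R.
Proof.
move=> pmu; rewrite -(sum_seq_prob_plan wfG (opponent_transition nu) pmu) /ip.
apply: ler_sum => x _; apply: ler_sum => a _; rewrite mulrC.
by rewrite ler_wpM2r ?loss_le// (plan_ge0 wfG).
Qed.

Lemma ip_ge0 mu (l : X -> A -> R) : is_policy G mu -> (forall x a, 0 <= l x a) -> 0 <= ip G mu l.
Proof.
move=> pmu l0; apply: sumr_ge0 => x _; apply: sumr_ge0 => a _.
by rewrite mulr_ge0// (plan_ge0 wfG).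
Qed.

Lemma sum_pstar_plan mu (x : X) : is_policy G mu ->
  \sum_(i | playable i) pstar_seq G i.1 * plan G mu i.1 i.2 = H%:R.
Proof.
move=> pmu; rewrite -(sum_playable (fun x a => pstar_seq G x * plan G mu x a)).
exact: (sum_seq_prob_plan wfG (pstar_transition R wfG x) pmu).
Qed.

Lemma policy_le1 mu x a : is_policy G mu -> mu x a <= 1.
Proof.
move=> pmu; have [m0 [mN m1]] := pmu x.
have [ax|/mN -> //] := boolP (a \in avail G x).
by rewrite -m1 (bigD1 a)//= lerDl sumr_ge0.
Qed.

Lemma transition_root_le1 q p x : transition H G q p -> par G x = None -> q x <= 1 :> R.
Proof.
move=> [[q0 q1] _] pE; rewrite -q1 (bigD1 x) ?(lvl_eq1 wfG) ?pE//= lerDl.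
exact: sumr_ge0.
Qed.

Lemma transition_step_le1 (q : X -> R) (p : X -> A -> X -> R) x y b : transition H G q p -> par G x = Some (y, b) ->
  0 <= p y b x <= 1.
Proof.
move=> [_ hp] pE; have [_ yb] := par_some wfG pE.
have [h0 h1] := hp y b yb (par_lt_H wfG pE).
rewrite h0 -h1 (bigD1 x) ?inE ?pE//= lerDl.
exact: sumr_ge0.
Qed.

(** One of the two factors [l] is spent on [plan * l <= 1], which IX estimates satisfy. The rest is
    linear in [l], hence within reach of the comparator events and of the bound [H] on the gain. *)
Lemma stability_le (k0 k1 : R) mu (l : X -> A -> R) : 0 <= k0 -> 0 <= k1 -> is_policy G mu ->
  (forall x a, 0 <= l x a) -> (forall x a, plan G mu x a * l x a <= 1) ->
  stability G k0 k1 mu l <=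
    k0 * \sum_(i | playable i) l i.1 i.2 / pstar_seq G i.1 + k1 * ip G mu l.
Proof.
move=> k00 k10 pmu l0 l1.
rewrite /stability /ip !sum_playable !mulr_sumr -big_split/=; apply: ler_sum => -[x a] _ /=.
have s0 : 0 < pstar_seq G x :> R := pstar_seq_gt0 R wfG x.
have m0 : 0 <= plan G mu x a := plan_ge0 wfG x a pmu.
set m := plan _ _ _ _ in m0 *; set s := pstar_seq _ _ in s0 *.
have -> : (l x a / s) ^+ 2 * (s * m) * (k0 + k1 * (s * m)) =
   k0 * (l x a / s) * (m * l x a) + k1 * (m * l x a) * (m * l x a).
  by field; rewrite gt_eqF.
have ml0 : 0 <= m * l x a by rewrite mulr_ge0.
apply: lerD; rewrite ler_piMr ?l1//; apply: mulr_ge0 => //.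
by rewrite divr_ge0// ltW.
Qed.

End Deterministic.

Lemma union_bound (R : realType) (d : measure_display) (Omega : measurableType d)
    (P : probability Omega R) (I : Type) (s : seq I) (B : I -> set Omega) (e : R) :
  (forall i, measurable (B i) /\ (P (B i) <= e%:E)%E) ->
  measurable (\big[setU/set0]_(i <- s) B i)%classic /\
  (P (\big[setU/set0]_(i <- s) B i)%classic <= ((size s)%:R * e)%:E)%E.
Proof.
move=> hB; elim: s => [|i s [mU IH]]; first by rewrite big_nil measure0 mul0r.
have [mi hi] := hB i; rewrite big_cons; split; first exact: measurableU.
apply: (@le_trans _ _ (P (B i) + P (\big[setU/set0]_(j <- s) B j)%classic)%E).
  exact: measureU2.
by rewrite /= -natr1 mulrDl mul1r addrC EFinD leeD.
Qed.

(** * Measurability and concentration along a run *)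

Section Run.
Variables (R : realType) (X A : finType) (H T : nat) (G : infotree X A).
Hypothesis wfG : wf_infotree H G.
Variables (Nu : Type) (p0 : Nu -> X -> R) (ptr : Nu -> X -> A -> X -> R)
  (rw : Nu -> X -> A -> R).
Hypothesis wfo : wf_opponent H G p0 ptr rw.
Variables (psi : R -> R) (eta gamma : R).
Hypothesis gamma_gt0 : 0 < gamma.
Variables (d : measure_display) (Omega : measurableType d) (P : probability Omega R)
  (F : nat -> set (set Omega)) (Xo : nat -> nat -> Omega -> X) (Ao : nat -> nat -> Omega -> A)
  (Ro : nat -> nat -> Omega -> R) (nu : nat -> Omega -> Nu) (mus : nat -> Omega -> X -> A -> R).
Hypothesis run : balanced_ftrl_run H T G p0 ptr rw psi (fun=> eta) (fun=> gamma)
  P F Xo Ao Ro nu mus.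

Let g x : R := gamma / pstar_seq G x.
Let los t x a w := loss G p0 ptr rw (nu t w) x a.
Let m t x a w := plan G (mus t w) x a.
(** The numerator of the IX estimate, with values in [[0, 1]] and conditional mean [m * los]. *)
Let Y t x a w : R :=
  if (Xo t (lvl G x) w == x) && (Ao t (lvl G x) w == a) then 1 - Ro t (lvl G x) w else 0.
Definition run_estimate t w x a : R :=
  ltilde G (fun=> gamma) (mus t w) (fun h => Xo t h w) (fun h => Ao t h w) (fun h => Ro t h w) x a.

Lemma run_sigma t : sigma_algebra setT (F t).
Proof. by case: run. Qed.

Lemma run_sub t : (F t `<=` measurable)%classic.
Proof. by case: run => _ []. Qed.

Lemma run_filtration t : (F t `<=` F t.+1)%classic.
Proof. by case: run => _ [_ []]. Qed.

Lemma run_obs t h : (1 <= t <= T)%N -> (1 <= h <= H)%N ->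
     F_meas_fin (F t) (Xo t h) /\ F_meas_fin (F t) (Ao t h) /\
     F_meas_real (F t) (Ro t h) /\ (forall w, 0 <= Ro t h w <= 1).
Proof. by case: run => _ [_ [_ [h1 _]]]; exact: h1. Qed.

Lemma run_opponent t : (1 <= t <= T)%N -> forall x a x',
     F_meas_real (F t.-1) (fun w => p0 (nu t w) x) /\
     F_meas_real (F t.-1) (fun w => ptr (nu t w) x a x') /\
     F_meas_real (F t.-1) (fun w => rw (nu t w) x a).
Proof. by case: run => _ [_ [_ [_ [h1 _]]]]; exact: h1. Qed.

Lemma run_player t : (1 <= t <= T)%N -> forall x a, F_meas_real (F t.-1) (fun w => mus t w x a).
Proof. by case: run => _ [_ [_ [_ [_ [h1 _]]]]]; exact: h1. Qed.

Lemma run_ftrl t w : (1 <= t <= T)%N -> is_policy G (mus t w) /\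
  forall mu', is_policy G mu' ->
    ftrl_obj H G psi (fun=> eta) (fun x a => \sum_(1 <= k < t) run_estimate k w x a) (mus t w) <=
    ftrl_obj H G psi (fun=> eta) (fun x a => \sum_(1 <= k < t) run_estimate k w x a) mu'.
Proof. by case: run => _ [_ [_ [_ [_ [_ [h1 _]]]]]] tT; exact: h1. Qed.

Lemma run_policy t w : (1 <= t <= T)%N -> is_policy G (mus t w).
Proof. by move=> /(run_ftrl w)[]. Qed.

Lemma run_law t : (1 <= t <= T)%N -> forall x a, a \in avail G x -> forall B, F t.-1 B ->
  (\int[P]_(w in B) (Y t x a w)%:E = \int[P]_(w in B) (m t x a w * los t x a w)%:E)%E.
Proof.
case: run => _ [_ [_ [_ [_ [_ [_ h]]]]]] tT x a ax B FB.
by have [_] := h t tT x a ax B FB.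
Qed.

Let subM F' (f1 f2 : Omega -> R) : sub_meas F' f1 -> sub_meas F' f2 ->
  sub_meas F' (fun w => f1 w * f2 w).
Proof. exact: (@bounded_measM _ _ (g_sigma_algebraType F')). Qed.

Let sub_unit t (f : Omega -> R) : F_meas_real (F t) f -> (forall w, 0 <= f w <= 1) ->
  sub_meas (F t) f.
Proof.
move=> mf f01; split; first exact: F_meas_realP (run_sigma t) mf.
by exists 1 => w; have /andP[f0 f1] := f01 w; rewrite ger0_norm.
Qed.

Lemma sub_meas_plan t x a : (1 <= t <= T)%N -> sub_meas (F t.-1) (m t x a).
Proof.
move=> tT.
have mmu y b : sub_meas (F t.-1) (fun w => mus t w y b).
  apply: sub_unit; first exact: run_player.
  move=> w; have pm := run_policy w tT; rewrite (policy_le1 _ _ pm) andbT.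
  by have [] := pm y.
elim/(lvl_ind wfG): x a => [x pE|x y b pE yb IH] a.
  by rewrite (_ : m t x a = fun w => mus t w x a)//; apply/funext => w; exact: (plan_root wfG).
rewrite (_ : m t x a = fun w => mus t w x a * m t y b w); last first.
  by apply/funext => w; exact: (plan_par wfG).
exact: subM.
Qed.

Lemma sub_meas_loss t x a : (1 <= t <= T)%N -> sub_meas (F t.-1) (los t x a).
Proof.
move=> tT; apply: subM; last first.
  apply: (@bounded_measB _ _ (g_sigma_algebraType (F t.-1))); first exact: bounded_meas_cst.
  apply: sub_unit; first by have [_ []] := run_opponent tT x a x.
  by move=> w; have [_ [_]] := wfo (nu t w); exact.
elim/(lvl_ind wfG): x {a} => [x pE|x y b pE yb IH].
  rewrite (_ : (fun w => _) = fun w => p0 (nu t w) x); last first.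
    by apply/funext => w; exact: (seq_prob_root wfG).
  have [a _] : exists a, a \in avail G x by apply/card_gt0P; exact: (avail_gt0 wfG).
  apply: sub_unit; first by have [] := run_opponent tT x a x.
  move=> w; have tr := opponent_transition wfo (nu t w).
  by rewrite (transition_root_le1 wfG tr pE) andbT; case: tr => -[].
rewrite (_ : (fun w => _) = fun w => ptr (nu t w) y b x * seq_prob G (p0 (nu t w)) (ptr (nu t w)) y);
  last by apply/funext => w; exact: (seq_prob_par wfG).
apply: subM => //; apply: sub_unit; first by have [_ []] := run_opponent tT y b x.
by move=> w; exact: (transition_step_le1 wfG (opponent_transition wfo (nu t w)) pE).
Qed.

Lemma Y_unit t x a w : (1 <= t <= T)%N -> 0 <= Y t x a w <= 1.
Proof.
move=> tT; have [_ [_ [_ /(_ w) r01]]] := run_obs tT (lvl_bounds wfG x).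
by rewrite /Y; case: ifP => _; lra.
Qed.

Lemma sub_meas_Y t x a : (1 <= t <= T)%N -> sub_meas (F t) (Y t x a).
Proof.
move=> tT; have [mX [mA [mR r01]]] := run_obs tT (lvl_bounds wfG x).
apply: (@bounded_meas_if _ _ (g_sigma_algebraType (F t))); last exact: bounded_meas_cst.
  by apply: measurable_and; exact: F_meas_finP (run_sigma t) _.
apply: (@bounded_measB _ _ (g_sigma_algebraType (F t))); first exact: bounded_meas_cst.
exact: sub_unit.
Qed.

Lemma cond_eq_Y t x a : (1 <= t <= T)%N -> a \in avail G x ->
  cond_eq P (F t.-1) (Y t x a) (fun w => m t x a w * los t x a w).
Proof.
move=> tT ax; apply: cond_eq_integral; [exact: run_sigma|exact: run_sub| | |].
- exact: sub_meas_bounded (run_sigma t) (@run_sub t) (sub_meas_Y _ _ tT).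
- apply: sub_meas_bounded (run_sigma t.-1) (@run_sub t.-1) _.
  by apply: subM; [exact: sub_meas_plan|exact: sub_meas_loss].
- exact: run_law.
Qed.

Let g_gt0 x : 0 < g x.
Proof. by rewrite divr_gt0// (pstar_seq_gt0 R wfG). Qed.

Lemma run_estimateE t x a w : run_estimate t w x a = Y t x a w / (m t x a w + g x).
Proof. by rewrite /run_estimate /ltilde /Y; case: ifP => // _; rewrite mul0r. Qed.

Lemma m_ge0 t x a w : (1 <= t <= T)%N -> 0 <= m t x a w.
Proof. by move=> tT; apply: (plan_ge0 wfG); exact: run_policy. Qed.

Lemma run_estimate_ge0 t w x a : (1 <= t <= T)%N -> 0 <= run_estimate t w x a.
Proof.
move=> tT; rewrite run_estimateE divr_ge0//; first by case/andP: (Y_unit x a w tT).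
by rewrite addr_ge0 ?m_ge0// ltW.
Qed.

Lemma m_estimate_le t w x a : (1 <= t <= T)%N -> m t x a w * run_estimate t w x a <=
  ((Xo t (lvl G x) w == x) && (Ao t (lvl G x) w == a))%:R.
Proof.
move=> tT; rewrite run_estimateE.
have m0 := m_ge0 x a w tT; have g0 := g_gt0 x; have /andP[_ Y1] := Y_unit x a w tT.
move: Y1; rewrite /Y; case: ifP => _; last by rewrite mul0r mulr0.
move=> Y1; rewrite mulrA ler_pdivrMr ?mul1r; last by lra.
by apply: le_trans (_ : m t x a w <= _); [rewrite ler_piMr|lra].
Qed.

Let gain t w := ip G (mus t w) (run_estimate t w).
(** The conditional mean of [gain t]: the weight [m / (m + g)] is known before the episode, and
    [m * los] is the mean of [Y]. *)
Let gain_mean t w :=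
  \sum_(i | playable G i) m t i.1 i.2 w / (m t i.1 i.2 w + g i.1) *
     (m t i.1 i.2 w * los t i.1 i.2 w).

(** An episode visits at most one pair per layer, and a visited pair contributes at most [1]. *)
Lemma gain_bounds t w : (1 <= t <= T)%N -> 0 <= gain t w <= H%:R.
Proof.
move=> tT; apply/andP; split.
  by apply: (ip_ge0 wfG); [exact: run_policy|move=> *; exact: run_estimate_ge0].
apply: (@le_trans _ _ (\sum_x (Xo t (lvl G x) w == x)%:R)).
  rewrite /gain /ip; apply: ler_sum => x _.
  apply: (@le_trans _ _ (\sum_(a in avail G x)
      ((Xo t (lvl G x) w == x) && (Ao t (lvl G x) w == a))%:R)).
    by apply: ler_sum => a _; exact: m_estimate_le.
  rewrite -natr_sum ler_nat; case: (_ == x) => /=; last by rewrite big1.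
  rewrite big_mkcond (bigD1 (Ao t (lvl G x) w))//= eqxx big1 ?addn0; first by case: ifP.
  by move=> a /negbTE; rewrite eq_sym => ->; case: ifP.
rewrite -(sum_by_level wfG).
apply: (@le_trans _ _ (\sum_(1 <= h < H.+1) 1)); last by rewrite sumr_const_nat subn1.
apply: ler_sum => h _.
rewrite (eq_bigr (fun x => (Xo t h w == x)%:R)); last by move=> x /eqP ->.
rewrite -natr_sum -[leRHS]/(1%:R) ler_nat big_mkcond (bigD1 (Xo t h w))//= eqxx big1 ?addn0; first by case: ifP.
by move=> x /negbTE; rewrite eq_sym => ->; case: ifP.
Qed.

Lemma sub_meas_inv t x a : (1 <= t <= T)%N ->
  sub_meas (F t.-1) (fun w => (m t x a w + g x)^-1).
Proof.
move=> tT; apply: (@bounded_meas_inv _ _ (g_sigma_algebraType (F t.-1)) _ (g x)).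
- exact: g_gt0.
- by move=> w; rewrite lerDr m_ge0.
- have [mm _] := sub_meas_plan x a tT.
  by apply: (@measurable_funD _ (g_sigma_algebraType (F t.-1))) => //; exact: measurable_cst.
Qed.

Lemma pred_sub t : (F t.-1 `<=` F t)%classic.
Proof. by case: t => [|t]//=; exact: run_filtration. Qed.

Lemma sub_meas_estimate t x a : (1 <= t <= T)%N ->
  sub_meas (F t) (fun w => run_estimate t w x a).
Proof.
move=> tT; under eq_fun do rewrite run_estimateE.
by apply: subM; [exact: sub_meas_Y|apply: sub_measS (@pred_sub t) (sub_meas_inv _ _ tT)].
Qed.

Lemma gain_supermart (lam : R) t : (1 <= t <= T)%N -> 0 <= lam ->
  sub_meas (F t) (fun w => lam * (gain_mean t w - gain t w) - (lam * H%:R) ^+ 2 / 2) /\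
  exp_supermart P (F t.-1) (fun w => lam * (gain_mean t w - gain t w) - (lam * H%:R) ^+ 2 / 2).
Proof.
move=> tT lam0.
have gainE : gain t = fun w => \sum_(i | playable G i)
    m t i.1 i.2 w / (m t i.1 i.2 w + g i.1) * Y t i.1 i.2 w.
  apply/funext => w; rewrite /gain /ip sum_playable; apply: eq_bigr => i _.
  by rewrite run_estimateE mulrA mulrAC.
have mV i : sub_meas (F t.-1) (fun w => m t i.1 i.2 w / (m t i.1 i.2 w + g i.1)).
  by apply: subM; [exact: sub_meas_plan|exact: sub_meas_inv].
have mml i : sub_meas (F t.-1) (fun w => m t i.1 i.2 w * los t i.1 i.2 w).
  by apply: subM; [exact: sub_meas_plan|exact: sub_meas_loss].
have mmean : sub_meas (F t.-1) (gain_mean t).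
  apply: (@bounded_meas_sum _ _ (g_sigma_algebraType (F t.-1))) => i _.
  exact: subM.
have mgain : sub_meas (F t) (gain t).
  rewrite gainE; apply: (@bounded_meas_sum _ _ (g_sigma_algebraType (F t))) => i _.
  by apply: subM; [exact: sub_measS (@pred_sub t) (mV i)|exact: sub_meas_Y].
split.
  apply: (@bounded_measB _ _ (g_sigma_algebraType (F t))); last exact: bounded_meas_cst.
  apply: subM; first exact: bounded_meas_cst.
  apply: (@bounded_measB _ _ (g_sigma_algebraType (F t))) => //.
  exact: sub_measS (@pred_sub t) mmean.
apply: lower_supermart => //; [exact: run_sigma|exact: run_sub| | |].
- exact: sub_meas_bounded (run_sigma t) (@run_sub t) mgain.
- by move=> w; exact: gain_bounds.
rewrite gainE; apply: cond_eq_sum; [exact: run_sigma|exact: run_sub|move=> i Pi; split].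
- apply: bounded_measM.
    exact: sub_meas_bounded (run_sigma t.-1) (@run_sub t.-1) (mV i).
  exact: sub_meas_bounded (run_sigma t) (@run_sub t) (sub_meas_Y _ _ tT).
- exact: sub_meas_bounded (run_sigma t.-1) (@run_sub t.-1) (subM (mV i) (mml i)).
- apply: cond_eqZ => //; last exact: cond_eq_Y.
  by move=> w; rewrite divr_ge0 ?addr_ge0 ?m_ge0// ltW.
Qed.

Lemma estimate_supermart t x a : (1 <= t <= T)%N -> a \in avail G x ->
  sub_meas (F t) (fun w => 2 * g x * (run_estimate t w x a - los t x a w)) /\
  exp_supermart P (F t.-1) (fun w => 2 * g x * (run_estimate t w x a - los t x a w)).
Proof.
move=> tT ax; split.
  apply: subM; first exact: bounded_meas_cst.
  apply: (@bounded_measB _ _ (g_sigma_algebraType (F t))); first exact: sub_meas_estimate.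
  exact: sub_measS (@pred_sub t) (sub_meas_loss _ _ tT).
under eq_fun do rewrite run_estimateE.
apply: ix_supermart; [exact: run_sigma|exact: run_sub|exact: g_gt0|exact: sub_meas_plan| | | | | |].
- by move=> w; exact: m_ge0.
- exact: sub_meas_loss.
- by move=> w; exact: (loss_ge0 wfG wfo).
- exact: sub_meas_bounded (run_sigma t) (@run_sub t) (sub_meas_Y _ _ tT).
- by move=> w; exact: Y_unit.
- exact: cond_eq_Y.
Qed.

Lemma concentration (lam c : R) : 0 <= lam ->
  exists E : set Omega, [/\ measurable E,
    ((1 - (AX G).+1%:R * expR (- c))%:E <= P E)%E &
    (forall w, E w ->
      lam * (\sum_(1 <= t < T.+1) gain_mean t w - \sum_(1 <= t < T.+1) gain t w)
        <= c + T%:R * ((lam * H%:R) ^+ 2 / 2) /\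
      forall x a, a \in avail G x ->
        \sum_(1 <= t < T.+1) run_estimate t w x a <=
        \sum_(1 <= t < T.+1) los t x a w + c / (2 * gamma) * pstar_seq G x)].
Proof.
move=> lam0.
pose S0 t w := lam * (gain_mean t w - gain t w) - (lam * H%:R) ^+ 2 / 2.
pose S1 (i : X * A) t w := 2 * g i.1 * (run_estimate t w i.1 i.2 - los t i.1 i.2 w).
pose B (S : nat -> Omega -> R) := [set w | c < \sum_(1 <= t < T.+1) (S t w : R)]%classic.
have B0 : measurable (B S0) /\ (P (B S0) <= (expR (- c))%:E)%E.
  by apply: exp_supermart_tail run_sigma run_sub run_filtration _ _ => t tT; have [] := gain_supermart tT lam0.
have B1 i : playable G i -> measurable (B (S1 i)) /\ (P (B (S1 i)) <= (expR (- c))%:E)%E.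
  by move=> Pi; apply: exp_supermart_tail run_sigma run_sub run_filtration _ _ => t tT;
    have [] := estimate_supermart tT Pi.
pose bad (o : option (X * A)) : set Omega :=
  if o is Some i then (if playable G i then B (S1 i) else set0) else B S0.
have hbad o : measurable (bad o) /\ (P (bad o) <= (expR (- c))%:E)%E.
  case: o => [i|]//=; case: ifPn => [/B1//|_].
  by rewrite measure0 lee_fin expR_ge0.
pose s := None :: map Some (enum (playable G)).
have [mU PU] := union_bound s hbad.
have ss : size s = (AX G).+1 by rewrite /= size_map -cardE card_playable.
exists (~` \big[setU/set0]_(o <- s) bad o)%classic; split.
- exact: measurableC.
- rewrite probability_setC// EFinB leeB// -ss; exact: PU.
- move=> w /= nw.
  have nb o : o \in s -> ~ bad o w.
    move=> os bw; apply: nw; rewrite -bigcup_seq; exists o => //.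
  split=> [|x a ax].
    have /negP := nb None (mem_head _ _); rewrite /B/= -leNgt => h.
    have : \sum_(1 <= t < T.+1) S0 t w =
      lam * (\sum_(1 <= t < T.+1) gain_mean t w - \sum_(1 <= t < T.+1) gain t w) -
      T%:R * ((lam * H%:R) ^+ 2 / 2).
      rewrite /S0 sumrB -mulr_sumr sumrB; congr (_ - _).
      by rewrite sumr_const_nat subn1 mulr_natl.
    by move: h => /[swap] ->; lra.
  have os : Some (x, a) \in s.
    by rewrite in_cons/= mem_map ?mem_enum; [exact: ax|exact: Some_inj].
  have := nb _ os; rewrite /bad (_ : playable G (x, a)); last exact: ax.
  move=> /negP.
  rewrite /B/= -leNgt /S1/= -mulr_sumr sumrB => h.
  rewrite -lerBlDl; have s0 : 0 < pstar_seq G x :> R := pstar_seq_gt0 R wfG x.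
  have -> : c / (2 * gamma) * pstar_seq G x = c / (2 * g x).
    by rewrite /g; field; rewrite !gt_eqF.
  have g2 : 0 < 2 * g x by rewrite mulr_gt0.
  by rewrite ler_pdivlMr// mulrC.
Qed.

End Run.

(** * Assembling the high-probability regret bound *)

Section Regret.
Variables (R : realType) (X A : finType) (H T : nat) (G : infotree X A).
Hypothesis wfG : wf_infotree H G.
Variables (Nu : Type) (p0 : Nu -> X -> R) (ptr : Nu -> X -> A -> X -> R)
  (rw : Nu -> X -> A -> R).
Hypothesis wfo : wf_opponent H G p0 ptr rw.
Hypothesis T_gt0 : (1 <= T)%N.
Variables (psi dpsi : R -> R) (k0 k1 eta gamma : R).
Hypothesis psi_stable : stable_regularizer psi dpsi k0 k1.
Hypothesis (k0_ge0 : 0 <= k0) (k1_ge0 : 0 <= k1) (eta_gt0 : 0 < eta) (gamma_gt0 : 0 < gamma).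
Variables (d : measure_display) (Omega : measurableType d) (P : probability Omega R)
  (F : nat -> set (set Omega)) (Xo : nat -> nat -> Omega -> X) (Ao : nat -> nat -> Omega -> A)
  (Ro : nat -> nat -> Omega -> R) (nu : nat -> Omega -> Nu) (mus : nat -> Omega -> X -> A -> R).
Hypothesis run : balanced_ftrl_run H T G p0 ptr rw psi (fun=> eta) (fun=> gamma)
  P F Xo Ao Ro nu mus.
Variable pen : R.
Hypothesis pen_bound : forall mu mu', is_policy G mu -> is_policy G mu' ->
  Psi_sum G psi mu - Psi_sum G psi mu' <= pen.

Let AXr : R := (AX G)%:R.
Let los t w := loss G p0 ptr rw (nu t w).
Let est t w := run_estimate G gamma Xo Ao Ro mus t w.

(** [H] is the sum of the visit probabilities of the pairs under any policy, here the first one of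
    the run, and each of the [AX] probabilities is at most [1]. *)
Lemma horizon_le_actions : (H <= AX G)%N.
Proof.
pose w : Omega := point; have pm := run_policy run w (T_gt0 : (1 <= 1 <= T)%N).
have tr := opponent_transition wfo (nu 1%N w).
rewrite -(ler_nat R) -(sum_seq_prob_plan wfG tr pm) AXE natr_sum.
apply: ler_sum => x _; rewrite -sum1_card natr_sum; apply: ler_sum => a ax.
exact: (seq_prob_plan_le1 wfG).
Qed.

Lemma regret_le_trivial mud w : is_policy G mud ->
  regret_vs T G p0 ptr rw nu mus mud w <= T%:R * H%:R.
Proof.
move=> pd; rewrite /regret_vs (_ : T%:R * H%:R = \sum_(1 <= t < T.+1) H%:R); last first.
  by rewrite sumr_const_nat subn1 mulr_natl.
rewrite big_nat_cond [leRHS]big_nat_cond; apply: ler_sum => t /andP[tT _].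
have h1 := ip_loss_le wfG wfo (nu t w) (run_policy run w tT).
have h2 := ip_ge0 wfG pd (loss_ge0 wfG wfo (nu t w)).
lra.
Qed.

(** Per pair the bias is [g * l * (m / (m + g)) <= g * l] with [g = gamma / pstar], and the sum of
    [l / pstar] is at most [AX] for every opponent. *)
Lemma bias_mean t w : (1 <= t <= T)%N ->
  ip G (mus t w) (los t w) -
  \sum_(i | playable G i) plan G (mus t w) i.1 i.2 /
      (plan G (mus t w) i.1 i.2 + gamma / pstar_seq G i.1) *
     (plan G (mus t w) i.1 i.2 * los t w i.1 i.2) <= gamma * AXr.
Proof.
move=> tT; have pm := run_policy run w tT.
apply: le_trans (ler_wpM2l (ltW gamma_gt0) (sum_loss_pstar_le wfG wfo (nu t w))).
rewrite mulr_sumr /ip sum_playable -sumrB; apply: ler_sum => -[x a] _ /=.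
have s0 : 0 < pstar_seq G x :> R := pstar_seq_gt0 R wfG x.
have m0 := plan_ge0 wfG x a pm; have l0 := loss_ge0 wfG wfo (nu t w) x a.
rewrite -/(los t w) in l0 *.
set m := plan _ _ _ _ in m0 *; set g := gamma / _; set l := los _ _ _ _ in l0 *.
have g0 : 0 < g by rewrite divr_gt0.
have mg0 : 0 < m + g by lra.
rewrite (_ : m * l - m / (m + g) * (m * l) = g * l * (m / (m + g))); last first.
  by field; rewrite gt_eqF.
rewrite (_ : gamma * (l / pstar_seq G x) = g * l); last by rewrite /g; ring.
have m1 : m / (m + g) <= 1 by rewrite ler_pdivrMr// mul1r lerDl ltW.
by rewrite ler_piMr// mulr_ge0// ltW.
Qed.

(** The error allowed at a pair is proportional to [pstar], and [pstar * plan] sums to [H] for every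
    policy; this is the benefit of dividing the IX parameter by [pstar]. *)
Lemma comparator_bias (c : R) w mud : is_policy G mud -> 0 <= c ->
  (forall x a, a \in avail G x -> \sum_(1 <= t < T.+1) est t w x a <=
      \sum_(1 <= t < T.+1) los t w x a + c / (2 * gamma) * pstar_seq G x) ->
  \sum_(1 <= t < T.+1) ip G mud (est t w) <=
  \sum_(1 <= t < T.+1) ip G mud (los t w) + H%:R * (c / (2 * gamma)).
Proof.
move=> pd c0 hE.
have sumE (l : nat -> X -> A -> R) : \sum_(1 <= t < T.+1) ip G mud (l t) =
    \sum_(i | playable G i) plan G mud i.1 i.2 * \sum_(1 <= t < T.+1) l t i.1 i.2.
  rewrite (eq_bigr (fun t => \sum_(i | playable G i) plan G mud i.1 i.2 * l t i.1 i.2)).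
    by rewrite exchange_big/=; apply: eq_bigr => i _; rewrite mulr_sumr.
  by move=> t _; rewrite /ip sum_playable.
rewrite !sumE -(sum_pstar_plan wfG (Xo 1%N 1%N w) pd) mulr_suml -big_split/=.
apply: ler_sum => i Pi.
apply: le_trans (ler_wpM2l (plan_ge0 wfG _ _ pd) (hE _ _ Pi)) _.
by rewrite le_eqVlt; apply/orP; left; apply/eqP; ring.
Qed.

(** The same event with weights [1 / pstar] instead of a plan: [pstar] cancels in the error, which
    leaves [c / (2 * gamma)] per pair. *)
Lemma sum_estimate_pstar_le (c : R) w : 0 <= c ->
  (forall x a, a \in avail G x -> \sum_(1 <= t < T.+1) est t w x a <=
      \sum_(1 <= t < T.+1) los t w x a + c / (2 * gamma) * pstar_seq G x) ->
  \sum_(1 <= t < T.+1) \sum_(i | playable G i) est t w i.1 i.2 / pstar_seq G i.1 <=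
  T%:R * AXr + AXr * (c / (2 * gamma)).
Proof.
move=> c0 hE.
apply: (@le_trans _ _ (\sum_(1 <= t < T.+1) (\sum_(i | playable G i) los t w i.1 i.2 / pstar_seq G i.1)
   + AXr * (c / (2 * gamma)))); last first.
  rewrite lerD2r (_ : T%:R * AXr = \sum_(1 <= t < T.+1) AXr); last first.
    by rewrite sumr_const_nat subn1 mulr_natl.
  by apply: ler_sum => t _; exact: (sum_loss_pstar_le wfG wfo).
rewrite exchange_big/= [X in _ <= X + _]exchange_big/=.
have -> : AXr * (c / (2 * gamma)) = \sum_(i | playable G i) c / (2 * gamma).
  by rewrite sumr_const card_playable /AXr mulr_natl.
rewrite -big_split/=; apply: ler_sum => i Pi; rewrite -!mulr_suml.
have s0 : 0 < pstar_seq G i.1 :> R := pstar_seq_gt0 R wfG _.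
by rewrite ler_pdivrMr// mulrDl divfK ?gt_eqF// hE.
Qed.

Lemma ftrl_regret_estimate w mud : is_policy G mud ->
  \sum_(1 <= t < T.+1) ip G (mus t w) (est t w) - \sum_(1 <= t < T.+1) ip G mud (est t w) <=
  pen / eta + eta * (k0 * (\sum_(1 <= t < T.+1) \sum_(i | playable G i)
     est t w i.1 i.2 / pstar_seq G i.1) + T%:R * (k1 * H%:R)).
Proof.
move=> pd; rewrite -sumrB.
have hT t : (1 <= t < T.+1)%N -> (1 <= t <= T)%N by rewrite ltnS.
apply: le_trans (ftrl_regret wfG psi_stable eta_gt0 T_gt0 _ _ pd) _.
- by move=> t tT x a; exact: (run_estimate_ge0 wfG gamma_gt0 run).
- by move=> t tT; exact: (run_ftrl run).
apply: lerD.
  rewrite ler_wpM2r ?invr_ge0 ?(ltW eta_gt0)//; apply: pen_bound => //.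
  exact: (run_policy run).
rewrite ler_wpM2l ?(ltW eta_gt0)//.
rewrite (_ : T%:R * (k1 * H%:R) = \sum_(1 <= t < T.+1) (k1 * H%:R)); last first.
  by rewrite sumr_const_nat subn1 mulr_natl.
rewrite mulr_sumr -big_split/= big_nat_cond [leRHS]big_nat_cond.
apply: ler_sum => t /andP[/hT tT _].
have pm := run_policy run w tT.
apply: le_trans (stability_le wfG k0_ge0 k1_ge0 pm _ _) _.
- by move=> x a; exact: (run_estimate_ge0 wfG gamma_gt0 run).
- move=> x a; apply: le_trans (m_estimate_le wfG gamma_gt0 run _ _ _ tT) _.
  by case: (_ && _).
- rewrite lerD2l ler_wpM2l//.
  by case/andP: (gain_bounds wfG gamma_gt0 run w tT).
Qed.

Variables (delta C : R).
Hypothesis delta01 : 0 < delta < 1.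
Let iota := ln (3 * AXr / delta).
Let Q := Num.sqrt (H%:R * AXr * T%:R).
Hypothesis gammaE : gamma = Num.sqrt (H%:R * iota / (2 * AXr * T%:R)).
Hypothesis C_bound : pen / eta + eta * (T%:R * (k0 * AXr + k1 * H%:R)) <= C * Q.

Lemma balanced_ftrl_whp :
  regret_whp T G p0 ptr rw P nu mus delta ((C + 3 * Num.sqrt (2 * iota)) * Q).
Proof.
have x0 : X := Xo 1%N 1%N point.
have /andP[d0 d1] := delta01.
have H0 : 0 < H%:R :> R by rewrite ltr0n (horizon_gt0 wfG x0).
have A0 : 0 < AXr by rewrite ltr0n (AX_gt0 wfG x0).
have T0 : 0 < T%:R :> R by rewrite ltr0n.
have HA : H%:R <= AXr by rewrite ler_nat horizon_le_actions.
have A1 : 1 <= AXr by rewrite ler1n (AX_gt0 wfG x0).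
have ratio1 : 1 < 3 * AXr / delta by rewrite ltr_pdivlMr// mul1r; lra.
have iota0 : 0 < iota by rewrite ln_gt0.
have Q0 : 0 < Q by rewrite sqrtr_gt0 !mulr_gt0.
pose U := Num.sqrt (2 * iota) * Q.
have U0 : 0 < U by rewrite mulr_gt0// sqrtr_gt0 mulr_gt0.
have Q2 : Q ^+ 2 = H%:R * AXr * T%:R by rewrite sqr_sqrtr// !mulr_ge0 ?ltW.
have U2 : U ^+ 2 = 2 * iota * (H%:R * AXr * T%:R).
  by rewrite exprMn Q2 sqr_sqrtr// mulr_ge0// ltW.
have gammaU : gamma = U / (2 * AXr * T%:R).
  apply/eqP; rewrite -(@eqrXn2 _ 2)// ?(ltW gamma_gt0)//; last first.
    by rewrite divr_ge0 ?(ltW U0)// !mulr_ge0// ltW.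
  rewrite gammaE sqr_sqrtr; last by rewrite divr_ge0 ?mulr_ge0// ltW.
  by rewrite expr_div_n U2; apply/eqP; field; rewrite !gt_eqF.
have biasU : T%:R * (gamma * AXr) = U / 2 by rewrite gammaU; field; rewrite !gt_eqF.
have gU : gamma * U = H%:R * iota.
  by rewrite gammaU mulrAC -expr2 U2; field; rewrite !gt_eqF.
have iotaU : H%:R * (iota / (2 * gamma)) = U / 2.
  by rewrite mulrA -gU; field; rewrite !gt_eqF.
have boundE : (C + 3 * Num.sqrt (2 * iota)) * Q = C * Q + 3 * U by rewrite /U; ring.
have [big|small] := leP (T%:R * H%:R) (C * Q + 3 * U).
  exists setT; split; first exact: measurableT.
  split; last by rewrite probability_setT lee_fin lerBlDr lerDl ltW.
  move=> w _ mud pd; rewrite boundE; apply: le_trans big.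
  exact: regret_le_trivial.
(* Chosen so that [lam * U = 2 * iota]: one [iota] pays for the tail, the other for the quadratic
   term, which equals [iota * H / AX] and fits because [H <= AX]. *)
pose lam := 2 * iota / U.
have lam0 : 0 < lam by rewrite divr_gt0// mulr_gt0.
have lamU : iota + T%:R * ((lam * H%:R) ^+ 2 / 2) <= lam * U.
  have -> : (lam * H%:R) ^+ 2 = 2 * iota * H%:R / (AXr * T%:R).
    rewrite /lam exprMn expr_div_n U2.
    by field; rewrite !gt_eqF.
  have -> : T%:R * (2 * iota * H%:R / (AXr * T%:R) / 2) = iota * (H%:R / AXr).
    by field; rewrite !gt_eqF.
  have -> : lam * U = iota + iota * 1 by rewrite /lam divfK ?gt_eqF//; ring.
  by rewrite lerD2l ler_wpM2l ?(ltW iota0)// ler_pdivrMr// mul1r.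
have [E [mE PE hE]] := concentration wfG wfo gamma_gt0 run iota (ltW lam0).
exists E; split => //; split; last first.
  (* The failure probability is [(AX + 1) * delta / (3 * AX)], and [AX + 1 <= 3 * AX]. *)
  apply: le_trans PE; rewrite lee_fin lerD2l lerN2 expRN lnK ?posrE; last by lra.
  rewrite invf_div mulrA ler_pdivrMr ?mulr_gt0// [leRHS]mulrC ler_wpM2r ?(ltW d0)//.
  by rewrite -natr1 -/AXr; lra.
move=> w Ew mud pd; have [h1 h2] := hE w Ew.
rewrite boundE /regret_vs sumrB.
have b1 : \sum_(1 <= t < T.+1) ip G (mus t w) (los t w) <=
    \sum_(1 <= t < T.+1) \sum_(i | playable G i) plan G (mus t w) i.1 i.2 /
      (plan G (mus t w) i.1 i.2 + gamma / pstar_seq G i.1) *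
      (plan G (mus t w) i.1 i.2 * los t w i.1 i.2) + U / 2.
  rewrite -biasU (_ : T%:R * (gamma * AXr) = \sum_(1 <= t < T.+1) gamma * AXr); last first.
    by rewrite sumr_const_nat subn1 mulr_natl.
  rewrite -big_split/= big_nat_cond [leRHS]big_nat_cond; apply: ler_sum => t /andP[tT _].
  by rewrite -lerBlDl; exact: bias_mean.
have b2 := comparator_bias pd (ltW iota0) h2.
have b3 := sum_estimate_pstar_le (ltW iota0) h2.
have b4 := ftrl_regret_estimate w pd.
rewrite iotaU in b2.
have b5 : \sum_(1 <= t < T.+1) \sum_(i | playable G i) plan G (mus t w) i.1 i.2 /
      (plan G (mus t w) i.1 i.2 + gamma / pstar_seq G i.1) *
      (plan G (mus t w) i.1 i.2 * los t w i.1 i.2) -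
    \sum_(1 <= t < T.+1) ip G (mus t w) (est t w) <= U.
  by rewrite -(ler_pM2l lam0); apply: le_trans h1 lamU.
have pen0 : 0 <= pen.
  by have := pen_bound pd pd; rewrite subrr.
(* [T * eta * k0 * AX] is one of the nonnegative terms collected in [C_bound], so in this case it is
   below [T * H]. *)
have k0small : eta * (k0 * AXr) <= H%:R.
  rewrite -(ler_pM2r T0) [leRHS]mulrC; apply: le_trans (ltW small).
  have p0' : 0 <= pen / eta by rewrite divr_ge0// ltW.
  have q0 : 0 <= eta * (T%:R * (k1 * H%:R)) by rewrite !mulr_ge0// ltW.
  have := C_bound; lra.
(* With [k0small] the excess of the estimates costs no more than the comparator bias
   [H * iota / (2 * gamma)]. *)
have extra : eta * (k0 * (AXr * (iota / (2 * gamma)))) <= U / 2.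
  rewrite -iotaU (_ : eta * _ = eta * (k0 * AXr) * (iota / (2 * gamma))); last by ring.
  by rewrite ler_wpM2r// divr_ge0 ?mulr_ge0// ltW.
have b6 := ler_wpM2l (ltW eta_gt0) (ler_wpM2l k0_ge0 b3).
(* The error terms add up to [5 * U / 2], within the allowed [3 * U]. *)
have := C_bound; lra.
Qed.

End Regret.

(** * Penalty and learning rates of the two regularizers *)

Lemma stable_tangent (R : realType) (psi dpsi : R -> R) (k0 k1 u v : R) :
  stable_regularizer psi dpsi k0 k1 -> 0 <= u -> 0 < v ->
  psi v + dpsi v * (u - v) <= psi u.
Proof.
move=> h u0 v0; have := h u v 0 u0 v0 (lexx _).
by rewrite expr0n !mul0r oppr0 addr0; lra.
Qed.

(** The sum for [mu] is at most [0] because its weights lie in [[0, 1]]. For [mu'] the tangent at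
    [H / AX] is used: the weights sum to [H] over [AX] pairs, so the linear part vanishes, as in
    Jensen's inequality. *)
Lemma Psi_sum_range (R : realType) (X A : finType) (H : nat) (G : infotree X A)
    (psi dpsi : R -> R) (k0 k1 : R) (x : X) (mu mu' : X -> A -> R) :
  wf_infotree H G -> stable_regularizer psi dpsi k0 k1 ->
  (forall v, 0 <= v <= 1 -> psi v <= 0) ->
  is_policy G mu -> is_policy G mu' ->
  Psi_sum G psi mu - Psi_sum G psi mu' <= - ((AX G)%:R * psi (H%:R / (AX G)%:R)).
Proof.
move=> wfG hpsi psi0 pmu pmu'.
have A0 : 0 < (AX G)%:R :> R by rewrite ltr0n (AX_gt0 wfG x).
have H0 : 0 < H%:R :> R by rewrite ltr0n (horizon_gt0 wfG x).
have w0 m y b : is_policy G m -> 0 <= pstar_seq G y * plan G m y b :> R.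
  by move=> pm; rewrite mulr_ge0 ?(plan_ge0 wfG)// ltW// (pstar_seq_gt0 R wfG).
have le0 : Psi_sum G psi mu <= 0.
  rewrite /Psi_sum -oppr_ge0 -sumrN sumr_ge0// => y _; rewrite oppr_ge0.
  rewrite -oppr_ge0 -sumrN sumr_ge0// => a ay; rewrite oppr_ge0 psi0// w0//.
  exact: (seq_prob_plan_le1 wfG (pstar_transition R wfG x)).
set u0 := H%:R / _; have u00 : 0 < u0 by rewrite divr_gt0.
have : (AX G)%:R * psi u0 <= Psi_sum G psi mu'; last by lra.
rewrite /Psi_sum sum_playable.
apply: (@le_trans _ _ (\sum_(i | playable G i)
    (psi u0 + dpsi u0 * (pstar_seq G i.1 * plan G mu' i.1 i.2 - u0)))); last first.
  by apply: ler_sum => i _; apply: (stable_tangent hpsi) => //; exact: w0.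
rewrite big_split/= -mulr_sumr sumrB (sum_pstar_plan wfG x pmu') !sumr_const card_playable.
rewrite -[psi u0 *+ _]mulr_natl -[u0 *+ _]mulr_natl (_ : (AX G)%:R * u0 = H%:R); first by rewrite subrr mulr0 addr0.
by rewrite mulrC divfK ?gt_eqF.
Qed.

Lemma policy_unique (R : realType) (X A : finType) (H : nat) (G : infotree X A)
    (mu mu' : X -> A -> R) :
  wf_infotree H G -> AX G = 1%N -> is_policy G mu -> is_policy G mu' -> mu = mu'.
Proof.
move=> wfG A1 pmu pmu'; apply/funext => x; apply/funext => a.
have /cards1P[b xb] : #|avail G x| == 1%N.
  rewrite eqn_leq (avail_gt0 wfG) andbT -A1 AXE (bigD1 x)//=.
  exact: leq_addr.
have [_ [mN m1]] := pmu x; have [_ [mN' m1']] := pmu' x.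
move: m1 m1'; rewrite xb !big_set1 => m1 m1'.
have [->|ab] := eqVneq a b; first by rewrite m1 m1'.
by rewrite mN ?mN'// xb inE.
Qed.

(** In terms of [p = u0 ^ a] and the square roots [u], [s], [c] everything is rational. The learning
    rate balances penalty and stability, both equal to [A * u * s / c], so the bound holds with
    equality. *)
Lemma tsallis_rate (R : realType) (a A T H : R) : 0 < a < 1 -> 0 < A -> 0 < T -> 0 < H ->
  let eta := Num.sqrt (2 * a * (1 - a) / T) * (H / A) `^ (a - 2^-1) in
  - (A * tsallis_psi a (H / A)) / eta +
    eta * (T * ((H / A) `^ (1 - a) / (2 * (1 - a)) * A + (H / A) `^ (- a) / (2 * a) * H)) <=
  Num.sqrt (2 / (a * (1 - a))) * Num.sqrt (H * A * T).
Proof.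
move=> /andP[a0 a1] A0 T0 H0; rewrite /tsallis_psi /=.
have a1' : 0 < 1 - a by lra.
set u0 := H / A; have u00 : 0 < u0 by rewrite divr_gt0.
have HE : H = A * u0 by rewrite /u0 mulrC divfK ?gt_eqF.
pose p := u0 `^ a; have p0 : 0 < p by exact: powR_gt0.
pose u := Num.sqrt u0; have ug0 : 0 < u by rewrite sqrtr_gt0.
have u2 : u0 = u ^+ 2 by rewrite sqr_sqrtr// ltW.
pose s := Num.sqrt T; have s0 : 0 < s by rewrite sqrtr_gt0.
have s2 : T = s ^+ 2 by rewrite sqr_sqrtr// ltW.
pose c := Num.sqrt (2 * a * (1 - a)).
have c0 : 0 < c by rewrite sqrtr_gt0 !mulr_gt0.
have c2 : c ^+ 2 = 2 * a * (1 - a) by rewrite sqr_sqrtr// !mulr_ge0// ltW.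
have -> : u0 `^ (1 - a) = u0 / p.
  by rewrite powRB ?(gt_eqF u00) ?implybT// powRr1// ltW.
have -> : u0 `^ (- a) = p^-1 by rewrite powRN.
have -> : u0 `^ (a - 2^-1) = p / u.
  by rewrite powRB ?(gt_eqF u00) ?implybT// powR12_sqrt// ltW.
have -> : Num.sqrt (2 * a * (1 - a) / T) = c / s.
  by rewrite sqrtrM ?sqrtrV ?mulr_ge0// ltW.
have -> : Num.sqrt (2 / (a * (1 - a))) = 2 / c.
  have -> : 2 / (a * (1 - a)) = (2 / c) ^+ 2.
    by rewrite expr_div_n c2; field; rewrite !gt_eqF.
  by rewrite sqrtr_sqr ger0_norm// divr_ge0// ltW.
have -> : Num.sqrt (H * A * T) = A * u * s.
  have -> : H * A * T = (A * u * s) ^+ 2 by rewrite HE s2 u2; ring.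
  by rewrite sqrtr_sqr ger0_norm// !mulr_ge0// ltW.
rewrite -/p.
have -> : T * (u0 / p / (2 * (1 - a)) * A + p^-1 / (2 * a) * H) =
    s ^+ 2 * (u ^+ 2 * A / p) / c ^+ 2.
  by rewrite c2 HE s2 u2; field; rewrite !gt_eqF.
rewrite le_eqVlt; apply/orP; left; apply/eqP.
by field; rewrite !gt_eqF.
Qed.

(** Penalty and stability are each at most half of the right-hand side [Z]. The penalty is
    [(H * ln A - H * ln H) / eta], and [H >= 1] allows its second term to be dropped. *)
Lemma shannon_rate (R : realType) (A T H : R) : 1 < A -> 0 < T -> 1 <= H ->
  let eta := Num.sqrt (2 * H * ln A / (A * T)) in
  - (A * shannon_psi (H / A)) / eta + eta * (T * (1 / 2 * A + 0 * H)) <=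
  Num.sqrt (2 * ln A) * Num.sqrt (H * A * T).
Proof.
move=> A1 T0 H1; rewrite /shannon_psi /=.
have A0 : 0 < A by lra.
have H0 : 0 < H by lra.
have L0 : 0 < ln A by rewrite ln_gt0.
set eta := Num.sqrt _; have eta0 : 0 < eta by rewrite sqrtr_gt0 divr_gt0 ?mulr_gt0.
set Z := _ * Num.sqrt _; have Z0 : 0 < Z by rewrite mulr_gt0// sqrtr_gt0 !mulr_gt0.
have Z2 : Z ^+ 2 = 2 * ln A * (H * A * T).
  by rewrite exprMn !sqr_sqrtr// !mulr_ge0// ltW.
have etaE : eta = Z / (A * T).
  have -> : eta = Num.sqrt ((Z / (A * T)) ^+ 2).
    by congr Num.sqrt; rewrite expr_div_n Z2; field; rewrite !gt_eqF.
  by rewrite sqrtr_sqr ger0_norm// divr_ge0 ?mulr_ge0// ltW.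
have h1 : - (A * (H / A * ln (H / A))) <= H * ln A.
  rewrite ln_div ?posrE// (_ : - _ = H * ln A - H * ln H); last by field; rewrite gt_eqF.
  by rewrite gerBl mulr_ge0 ?ln_ge0// ltW.
have h2 : - (A * (H / A * ln (H / A))) / eta <= Z / 2.
  rewrite ler_pdivrMr// (le_trans h1)// etaE le_eqVlt; apply/orP; left; apply/eqP.
  have -> : Z / 2 * (Z / (A * T)) = Z ^+ 2 / (2 * (A * T)) by field; rewrite !gt_eqF.
  by rewrite Z2; field; rewrite !gt_eqF.
have h3 : eta * (T * (1 / 2 * A + 0 * H)) = Z / 2 by rewrite etaE; field; rewrite !gt_eqF.
by rewrite h3; lra.
Qed.

Unset Implicit Arguments.

Theorem theorem3 (R : realType) (X A : finType) (H T : nat) (G : infotree X A)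
    (Nu : Type) (p0 : Nu -> X -> R) (ptr : Nu -> X -> A -> X -> R)
    (rw : Nu -> X -> A -> R) (delta : R) :
  wf_infotree H G ->
  wf_opponent H G p0 ptr rw ->
  0 < delta < 1 ->
  (1 <= T)%N ->
  let AXr : R := (AX G)%:R in
  let iota : R := ln (3 * AXr / delta) in
  let gamma : nat -> R := fun _ => Num.sqrt (H%:R * iota / (2 * AXr * T%:R)) in
  (* (i) Tsallis regularizer *)
  (forall alpha : R, 0 < alpha < 1 ->
   let eta : nat -> R := fun _ =>
     Num.sqrt (2 * alpha * (1 - alpha) / T%:R) * (H%:R / AXr) `^ (alpha - 2^-1) in
   forall (d : measure_display) (Omega : measurableType d) (P : probability Omega R)
     (F : nat -> set (set Omega))
     (Xo : nat -> nat -> Omega -> X) (Ao : nat -> nat -> Omega -> A)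
     (Ro : nat -> nat -> Omega -> R)
     (nu : nat -> Omega -> Nu) (mus : nat -> Omega -> X -> A -> R),
   balanced_ftrl_run H T G p0 ptr rw (tsallis_psi alpha) eta gamma P F Xo Ao Ro nu mus ->
   regret_whp T G p0 ptr rw P nu mus delta
     ((Num.sqrt (2 / (alpha * (1 - alpha))) + 3 * Num.sqrt (2 * iota))
        * Num.sqrt (H%:R * AXr * T%:R))) /\
  (* (ii) Shannon regularizer *)
  (let eta : nat -> R := fun _ =>
     Num.sqrt (2 * H%:R * ln AXr / (AXr * T%:R)) in
   forall (d : measure_display) (Omega : measurableType d) (P : probability Omega R)
     (F : nat -> set (set Omega))
     (Xo : nat -> nat -> Omega -> X) (Ao : nat -> nat -> Omega -> A)
     (Ro : nat -> nat -> Omega -> R)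
     (nu : nat -> Omega -> Nu) (mus : nat -> Omega -> X -> A -> R),
   balanced_ftrl_run H T G p0 ptr rw (@shannon_psi R) eta gamma P F Xo Ao Ro nu mus ->
   regret_whp T G p0 ptr rw P nu mus delta
     ((Num.sqrt (2 * ln AXr) + 3 * Num.sqrt (2 * iota))
        * Num.sqrt (H%:R * AXr * T%:R))).
Proof.
move=> wfG wfo d01 T1 AXr iota gamma.
have T0 : 0 < T%:R :> R by rewrite ltr0n.
have /andP[d0 d1] := d01.
(* Positivity requires a nonempty tree; each run supplies an element of [X], the information set
   observed at the base point of [Omega]. *)
have pos (x : X) : [/\ 0 < H%:R :> R, 0 < AXr & 0 < gamma 0%N].
  have H0 : 0 < H%:R :> R by rewrite ltr0n (horizon_gt0 wfG x).
  have A0 : 0 < AXr by rewrite ltr0n (AX_gt0 wfG x).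
  have A1 : 1 <= AXr by rewrite ler1n (AX_gt0 wfG x).
  have r1 : 1 < 3 * AXr / delta by rewrite ltr_pdivlMr// mul1r; lra.
  by split=> //; rewrite sqrtr_gt0 divr_gt0 ?mulr_gt0// ln_gt0.
split=> [alpha al01 eta|eta] d Omega P F Xo Ao Ro nu mus run;
    have [H0 A0 g0] := pos (Xo 1%N 1%N point).
  have /andP[al0 al1] := al01.
  have u0 : 0 < H%:R / AXr by rewrite divr_gt0.
  have stable := tsallis_stable al01 u0.
  have eta0 : 0 < eta 0%N.
    by rewrite mulr_gt0 ?powR_gt0// sqrtr_gt0 divr_gt0 ?mulr_gt0//; lra.
  apply: (balanced_ftrl_whp wfG wfo T1 stable _ _ eta0 g0 run _ d01 erefl
    (tsallis_rate al01 A0 T0 H0)).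
  - by rewrite divr_ge0 ?powR_ge0//; lra.
  - by rewrite divr_ge0 ?powR_ge0//; lra.
  - move=> mu mu'; apply: Psi_sum_range wfG stable _ => //.
      exact: (Xo 1%N 1%N point).
    by move=> v _; rewrite oppr_le0 powR_ge0.
(* With a single pair [ln AX = 0], so the learning rate is zero and the general bound does not
   apply; but then there is only one policy and the regret vanishes. *)
have [AX1|AXn1] := eqVneq (AX G) 1%N.
  exists setT; split; first exact: measurableT.
  split; last by rewrite probability_setT lee_fin lerBlDr lerDl ltW.
  move=> w _ mud pd; rewrite /regret_vs big_nat_cond big1 => [|t /andP[tT _]].
    by rewrite mulr_ge0 ?sqrtr_ge0// addr_ge0 ?mulr_ge0 ?sqrtr_ge0.
  by rewrite (policy_unique wfG AX1 (run_policy run w tT) pd) subrr.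
have A1 : 1 < AXr.
  by rewrite ltr1n ltn_neqAle eq_sym AXn1 (AX_gt0 wfG (Xo 1%N 1%N point)).
have H1 : 1 <= H%:R :> R by rewrite ler1n (horizon_gt0 wfG (Xo 1%N 1%N point)).
have eta0 : 0 < eta 0%N by rewrite sqrtr_gt0 divr_gt0 ?mulr_gt0// ln_gt0.
apply: (balanced_ftrl_whp wfG wfo T1 (@shannon_stable R) _ _ eta0 g0 run _ d01 erefl
  (shannon_rate A1 T0 H1)) => //.
move=> mu mu'; apply: Psi_sum_range wfG (@shannon_stable R) _ => //.
  exact: (Xo 1%N 1%N point).
by move=> v /andP[v0 v1]; rewrite /shannon_psi mulr_ge0_le0// ln_le0.
Qed.
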